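(* For each $n$, let $\ell=\ell(n)$ be a positive integer and $m_1,\dots,m_\ell\in\{0,\dots,n\}$; for $1\le i\le \ell$ choose $A_i$ independently and uniformly at random from the set of all $m_i$-element subsets of $\{1,\dots,n\}$, and let $Y_n=n-|\bigcup_{i=1}^\ell A_i|$. Let $u_j=m_j/n$. Suppose $\ell\to\infty$, $u_j=O(1/\ell)$ uniformly for all $1\le j\le \ell$, and $\sum_{i=1}^\ell u_i>c$ for some positive constant $c$. Then $Y_n$ is asymptotically normal with mean and variance, respectively, $$\mu_n=n\prod_{i=1}^\ell (1-u_i),\qquad \sigma_n^2=n\left(1-\left(1+\sum_{i=1}^\ell u_i\right)\prod_{i=1}^\ell (1-u_i)\right)\prod_{i=1}^\ell (1-u_i),$$ i.e. $(Y_n-\mu_n)/\sigma_n$ tends in distribution to the standard normal. *)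

(* Defs.v *)
From HB Require Import structures.
From mathcomp Require Import all_boot all_order all_algebra.
From mathcomp Require Import all_classical all_reals all_analysis.
From mathcomp Require Import measurable_realfun.

Set Implicit Arguments.
Unset Strict Implicit.
Unset Printing Implicit Defensive.

Import Order.TTheory GRing.Theory Num.Theory.
Import numFieldNormedType.Exports.

Local Open Scope classical_set_scope.
Local Open Scope ring_scope.

(* The finite type {set U} carries the discrete sigma-algebra, so that a random
   subset of U is a random variable {RV P >-> {set U}}. *)
HB.instance Definition _ (U : finType) := isPointed.Build {set U} finset.set0.
HB.instance Definition _ (U : finType) :=
  @isMeasurable.Build default_measure_display {set U} discrete_measurable
    discrete_measurable0 discrete_measurableC discrete_measurableU.

Definition mutually_independent d d' (T : measurableType d)
    (E : measurableType d') (R : realType) (P : probability T R)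
    (I : finType) (X : I -> {RV P >-> E}) : Prop :=
  forall (J : {set I}) (B : I -> set E),
    (forall i, i \in J -> measurable (B i)) ->
    P (\bigcap_(i in [set` J]) (X i @^-1` B i)) =
      (\prod_(i in J) P (X i @^-1` B i))%E.

Definition uniform_in d (T : measurableType d) (R : realType)
    (P : probability T R) (U : finType) (X : {RV P >-> {set U}})
    (F : {set {set U}}) : Prop :=
  forall S : {set U},
    P (X @^-1` [set S]) = (if S \in F then (#|F|%:R)^-1 else 0)%:E.

(* Pointwise convergence of the distribution functions at every continuity
   point of the distribution function of the limit law Q. *)
Definition cvg_in_distribution (d : nat -> measure_display)
    (T : forall n, measurableType (d n)) (R : realType)
    (P : forall n, probability (T n) R) (X : forall n, {RV (P n) >-> R})
    (Q : probability (measurableTypeR R) R) : Prop :=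
  forall x : R, {for x, continuous (fun r : R => Q `]-oo, r]%classic)} ->
    cdf (X n) x @[n --> \oo] --> Q `]-oo, x]%classic.

Section standardize.
Context d (T : measurableType d) (R : realType) (P : probability T R).
Context (X : {RV P >-> R}) (mu sigma : R).

Definition standardize_fun (w : T) : R := (X w - mu) / sigma.

Let measurable_standardize_fun : measurable_fun [set: T] standardize_fun.
Proof. by apply: measurable_funM => //; exact: measurable_funB. Qed.

HB.instance Definition _ :=
  isMeasurableFun.Build _ _ _ _ standardize_fun measurable_standardize_fun.

Definition standardize : {RV P >-> R} := standardize_fun.

End standardize.

Section uncovered.
Context d (T : measurableType d) (R : realType) (P : probability T R).
Context (n l : nat) (A : 'I_l -> {RV P >-> {set 'I_n}}).

Definition uncovered_fun (w : T) : R :=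
  n%:R - #|(\bigcup_(i < l) A i w)%SET|%:R.

Let uncovered_funE w :
  uncovered_fun w = \sum_(x < n) \prod_(i < l) (x \notin A i w)%:R.
Proof.
rewrite /uncovered_fun; set B := (\bigcup_(i < l) A i w)%SET.
have -> : n%:R - #|B|%:R = #|~: B|%:R :> R.
  by rewrite [in RHS]cardsCs finset.setCK card_ord natrB// -[leqRHS]card_ord max_card.
rewrite -sum1_card natr_sum big_mkcond/=; apply: eq_bigr => x _.
rewrite finset.in_setC; have [/bigcupP[i _ xi]|xB] := boolP (x \in B).
  by rewrite (bigD1 i)//= xi mul0r.
rewrite big1// => i _; case: (boolP (x \in A i w)) => // xi.
by case/negP: xB; apply/bigcupP; exists i.
Qed.

Let measurable_uncovered_fun : measurable_fun [set: T] uncovered_fun.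
Proof.
rewrite (_ : uncovered_fun = fun w => \sum_(x < n) \prod_(i < l) (x \notin A i w)%:R).
  apply: measurable_sum => x; apply: measurable_prod => i _.
  exact: (@measurableT_comp _ _ _ _ _ _
    (fun S : {set 'I_n} => (x \notin S)%:R : R) _ (A i)).
by apply/funext => w; exact: uncovered_funE.
Qed.

HB.instance Definition _ :=
  isMeasurableFun.Build _ _ _ _ uncovered_fun measurable_uncovered_fun.

Definition uncovered : {RV P >-> R} := uncovered_fun.

End uncovered.

Section parameters.
Context (R : realType) (n l : nat) (m : 'I_l -> nat).

Definition density (j : 'I_l) : R := (m j)%:R / n%:R.

Definition asym_mean : R := n%:R * \prod_(i < l) (1 - density i).

Definition asym_variance : R :=
  n%:R
  * (1 - (1 + \sum_(i < l) density i) * \prod_(i < l) (1 - density i))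
  * \prod_(i < l) (1 - density i).

End parameters.

Arguments density R n {l} m j.
Arguments asym_mean R n {l} m.
Arguments asym_variance R n {l} m.

(* Main.v *)
(* The generating function of the number Y of uncovered points has only real
   roots, so that Y is distributed as a sum of independent Bernoulli variables.
   Indeed E (1 + x)^Y = \sum_k C(n, k) \prod_i (C(n-k, m_i) / C(n, m_i)) x^k is
   obtained from (1 + x)^n by operators p |-> a p - x p', which preserve
   polynomials of degree at most a with only nonpositive roots.  Lindeberg's
   replacement argument then compares E f((Y - mu) / sigma) with its Gaussian
   analogue for smooth f: every Bernoulli mean is traded for the mean under a
   centered Gaussian of the same variance, at a cost of third order, and the
   Gaussian means compose by the semigroup property.  It remains to see that
   the exact variance is equivalent to the asymptotic one and tends to infinity,
   and to squeeze indicators of half-lines between smooth functions. *)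
Require Import Defs.
From HB Require Import structures.
From mathcomp Require Import all_boot all_order all_algebra.
From mathcomp Require Import all_classical all_reals all_analysis.
From mathcomp Require Import measurable_realfun.
From mathcomp Require Import ring lra complex.

Set Implicit Arguments.
Unset Strict Implicit.
Unset Printing Implicit Defensive.

Import Order.TTheory GRing.Theory Num.Theory.
Import numFieldNormedType.Exports.

Local Open Scope classical_set_scope.
Local Open Scope ring_scope.

(** * Gaussian averages *)

(** Each [A i] is drawn without replacement, so the indicators that single points stay uncovered are
    dependent; independence has to be recovered from the roots. The Bernoulli and Gaussian variables
    are never constructed: they occur only as averaging operators on functions, so no coupling and
    no product space is needed. A normalized Bernoulli summand takes two values at distance 1/sigma,
    so its third absolute moment is at most its variance over sigma. As the normalized variances add
    up to about 1, the total cost of the replacement is O(1/sigma). The mean [asym_mean] is exact.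
    The obstacle in the variance is that it is of order n while it is a difference of terms of order
    n^2, so the cancellation has to be carried out exactly before anything is estimated. There u_j =
    O(1/l) keeps the product of the 1 - u_i away from 0, and the lower bound on the sum of the u_i
    does the same for the factor 1 - (1 + sum u_i) prod (1 - u_i). *)

Lemma expR_taylor2 (R : realType) (x : R) :
  `|expR x - (1 + x + x ^+ 2 / 2)| <= `|x| ^+ 3 * expR `|x|.
Proof.
have partial_le n : `|series (exp_coeff x) n.+3 - (1 + x + x ^+ 2 / 2)|
    <= `|x| ^+ 3 * expR `|x|.
  rewrite /series/= !big_nat_recl//= /exp_coeff/= !factS fact0 expr0 expr1.
  set s := \sum_(0 <= i < n) _.
  have -> : 1 / 1%:R + (x / (1 * 1)%:R + (x ^+ 2 / (2 * (1 * 1))%:R + s))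
      - (1 + x + x ^+ 2 / 2) = s by rewrite !mulnE/=; field.
  apply: (@le_trans _ _ (`|x| ^+ 3 * series (exp_coeff `|x|) n)).
    rewrite /series/= mulr_sumr; apply: (le_trans (ler_norm_sum _ _ _)).
    apply: ler_sum => i _; rewrite normrM normfV normr_nat normrX.
    rewrite -[i.+3]/(3 + i)%N exprD -mulrA ler_wpM2l ?exprn_ge0//.
    rewrite ler_wpM2l ?exprn_ge0// lef_pV2 ?posrE ?ltr0n ?fact_gt0//.
    by rewrite ler_nat; apply: leq_fact; rewrite leq_addl.
  rewrite ler_wpM2l ?exprn_ge0//.
  apply: nondecreasing_cvgn_le; last exact: is_cvg_series_exp_coeff.
  by apply/nondecreasing_seqP => k; rewrite /series/= big_nat_recr//= lerDl exp_coeff_ge0.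
have cvgx : `|series (exp_coeff x) k - (1 + x + x ^+ 2 / 2)| @[k --> \oo]
    --> `|expR x - (1 + x + x ^+ 2 / 2)|.
  apply: cvg_norm; apply: cvgB; last exact: cvg_cst.
  exact: is_cvg_series_exp_coeff.
rewrite -(cvg_lim _ cvgx)//; apply: limr_le; first by apply/cvg_ex; eexists; exact: cvgx.
by near=> k; rewrite -[k](@subnK 3) ?addn3//; near: k; exact: nbhs_infty_ge.
Unshelve. all: by end_near. Qed.

Section gauss.
Context {R : realType}.
Implicit Types (f g : R -> R) (x y t s v : R).
Notation mu := (@lebesgue_measure R).

Lemma integrable_scale f (k : R) : mu.-integrable setT (fun y => (f y)%:E) ->
  mu.-integrable setT (fun y => (k * f y)%:E).
Proof. by move=> fi; under eq_fun do rewrite EFinM; exact: integrableZl. Qed.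

Lemma integrable_add f g : mu.-integrable setT (fun y => (f y)%:E) ->
  mu.-integrable setT (fun y => (g y)%:E) ->
  mu.-integrable setT (fun y => (f y + g y)%:E).
Proof. by move=> fi gi; exact: (integrableD measurableT fi gi). Qed.

(** Completing the square: an exponential tilt of a Gaussian density only translates it, which
    reduces exponential moments to total mass 1. *)
Lemma expR_normal_pdf x s t y : s != 0 ->
  expR (t * (y - x)) * normal_pdf x s y =
  expR (t ^+ 2 * s ^+ 2 / 2) * normal_pdf (x + t * s ^+ 2) s y.
Proof.
move=> s0; rewrite !normal_pdfE// /normal_fun !(mulrCA _ (normal_peak s)).
congr (_ * _); rewrite -!expRD; congr expR.
by rewrite !mulr2n; field; rewrite -mulr2n mulrn_eq0/= mulf_neq0.
Qed.

Lemma integrable_bounded_normal_pdf f x s (M : R) : measurable_fun setT f ->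
  (forall y, `|f y| <= M) ->
  mu.-integrable setT (fun y => (f y * normal_pdf x s y)%:E).
Proof.
move=> mf fM.
apply: (@le_integrable _ _ _ mu setT _ _ (fun y => (M * normal_pdf x s y)%:E)) => //.
- by apply/measurable_EFinP/measurable_funM => //; exact: measurable_normal_pdf.
- move=> y _; rewrite lee_fin !normrM ler_wpM2r// (le_trans (fM y))//.
  exact: ler_norm.
- exact/integrable_scale/integrable_normal_pdf.
Qed.

Lemma integrable_expR_normal_pdf x s t : s != 0 ->
  mu.-integrable setT (fun y => (expR (t * (y - x)) * normal_pdf x s y)%:E).
Proof.
move=> s0; under eq_fun do rewrite expR_normal_pdf// EFinM.
by apply: integrableZl => //; exact: integrable_normal_pdf.
Qed.

Lemma Rintegral_normal_pdf x s : (\int[mu]_y normal_pdf x s y)%R = 1.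
Proof. by rewrite /Rintegral integral_normal_pdf. Qed.

Lemma Rintegral_expR_normal_pdf x s t : s != 0 ->
  (\int[mu]_y (expR (t * (y - x)) * normal_pdf x s y))%R
  = expR (t ^+ 2 * s ^+ 2 / 2).
Proof.
move=> s0; under eq_Rintegral do rewrite expR_normal_pdf//.
rewrite RintegralZl// ?Rintegral_normal_pdf ?mulr1//.
exact: integrable_normal_pdf.
Qed.

End gauss.

(* Locked: otherwise failing unifications unfold the Lebesgue integral. *)
HB.lock Definition gauss_avg (R : realType) (v : R) (f : R -> R) (x : R) : R :=
  if v == 0 then f x
  else (\int[lebesgue_measure]_y (f y * normal_pdf x (Num.sqrt v) y))%R.

Section gauss_avg.
Context {R : realType}.
Implicit Types (f g : R -> R) (x y t s v w : R).
Notation mu := (@lebesgue_measure R).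

(** The range [0, 1] makes all Gaussian integrals finite, gives the sign that Tonelli's theorem
    wants, and is preserved by Bernoulli and Gaussian averages. *)
Definition unit_valued f := measurable_fun setT f /\ forall y, 0 <= f y <= 1.

Lemma gauss_avgE v f x : v != 0 ->
  gauss_avg v f x = (\int[mu]_y (f y * normal_pdf x (Num.sqrt v) y))%R.
Proof. by rewrite gauss_avg.unlock => /negbTE ->. Qed.

(** Variance 0 has no density and is read as a point mass. It does occur: a Bernoulli parameter 0 or
    1 has variance 0. *)
Lemma gauss_avg0 f x : gauss_avg 0 f x = f x.
Proof. by rewrite gauss_avg.unlock eqxx. Qed.

Lemma unit_valued_integrable f x s : unit_valued f ->
  mu.-integrable setT (fun y => (f y * normal_pdf x s y)%:E).
Proof.
move=> [mf f01]; apply: (@integrable_bounded_normal_pdf _ _ _ _ 1) => // y.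
by have /andP[f0 f1] := f01 y; rewrite ger0_norm.
Qed.

(** Monotonicity and total mass 1 together: a uniform error passes through a Gaussian average
    without growing. *)
Lemma gauss_avg_le v f g x (e : R) : unit_valued f -> unit_valued g ->
  (forall y, f y <= g y + e) -> gauss_avg v f x <= gauss_avg v g x + e.
Proof.
move=> uf ug fg; have [->|v0] := eqVneq v 0; [by rewrite !gauss_avg0|rewrite !gauss_avgE//].
have ie : mu.-integrable setT (fun y => (e * normal_pdf x (Num.sqrt v) y)%:E).
  exact/integrable_scale/integrable_normal_pdf.
rewrite -[X in _ + X]mulr1 -(Rintegral_normal_pdf x (Num.sqrt v)).
rewrite -RintegralZl//; last exact: integrable_normal_pdf.
rewrite -RintegralD//; last exact: unit_valued_integrable.
apply: le_Rintegral => //; first exact: unit_valued_integrable.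
  exact: (integrable_add (unit_valued_integrable x (Num.sqrt v) ug) ie).
move=> y _; rewrite -mulrDl ler_wpM2r// normal_pdf_ge0//.
Qed.

Lemma gauss_avg_affine v f g x (a b : R) : unit_valued f -> unit_valued g ->
  gauss_avg v (fun y => a * f y + b * g y) x
  = a * gauss_avg v f x + b * gauss_avg v g x.
Proof.
move=> uf ug; have [->|v0] := eqVneq v 0; [by rewrite !gauss_avg0|rewrite !gauss_avgE//].
rewrite -!RintegralZl//; try exact: unit_valued_integrable.
rewrite -RintegralD//.
- by apply: eq_Rintegral => y _; rewrite mulrDl !mulrA.
- exact/integrable_scale/unit_valued_integrable.
- exact/integrable_scale/unit_valued_integrable.
Qed.

Lemma ge0_integral_shift f (a : R) : continuous f -> (forall y, 0 <= f y) ->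
  (\int[mu]_y (f y)%:E = \int[mu]_y (f (y + a))%:E)%E.
Proof.
move=> cf f0.
pose F y : R := y + a.
have dE : F^`()%classic = cst 1.
  apply/funext => y; rewrite derive1E deriveD// derive_cst.
  by rewrite (@derive_id R R) addr0.
rewrite (@increasing_ge0_integration_by_substitutionT _ F f)// ?dE.
- by apply: eq_integral => y _ /=; rewrite mulrfctE /= mulr1.
- by move=> y z; rewrite ltrD2r.
- by move=> y; exact: cvg_cst.
- exact: is_cvg_cst.
- exact: is_cvg_cst.
- exact: cvg_addrr_Ny.
- exact: cvg_addrr.
Qed.

Lemma normal_pdf_translate x s y (a : R) : s != 0 ->
  normal_pdf (x + a) s (y + a) = normal_pdf x s y.
Proof.
move=> s0; rewrite !(normal_pdfE _ s0) /normal_fun.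
by rewrite [x + a]addrC opprD addrA addrK.
Qed.

Lemma gauss_avg_translate v f x (a : R) : 0 <= v -> continuous f ->
  (forall y, 0 <= f y) ->
  gauss_avg v f (x + a) = gauss_avg v (fun y => f (y + a)) x.
Proof.
rewrite le0r => /orP[/eqP ->|v_gt0] cf f0; first by rewrite !gauss_avg0.
have s0 : Num.sqrt v != 0 by rewrite gt_eqF// sqrtr_gt0.
have v0 : v != 0 by rewrite gt_eqF.
rewrite !(gauss_avgE _ _ v0) /Rintegral (@ge0_integral_shift _ a).
- apply: (congr1 fine); apply: eq_integral => y _ /=.
  by rewrite (normal_pdf_translate _ _ _ s0).
- have cp : continuous (normal_pdf (x + a) (Num.sqrt v)).
    exact: continuous_normal_pdf.
  by move=> y; exact: (cvgM (cf y) (cp y)).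
- by move=> y; rewrite mulr_ge0 ?normal_pdf_ge0.
Qed.

(** Bayes' rule for Gaussians: the joint density of (y, z) is the marginal density of z times the
    conditional density of y given z. Integrating over y leaves the marginal. *)
Lemma normal_pdf_convolution v w x y z : 0 < v -> 0 < w ->
  normal_pdf x (Num.sqrt v) y * normal_pdf y (Num.sqrt w) z
  = normal_pdf x (Num.sqrt (v + w)) z
    * normal_pdf ((w * x + v * z) / (v + w)) (Num.sqrt (v * w / (v + w))) y.
Proof.
move=> v0 w0; have vw0 : 0 < v + w by rewrite addr_gt0.
have vwd0 : 0 < v * w / (v + w) by rewrite divr_gt0 ?mulr_gt0.
have sqrt_neq0 r : 0 < r -> Num.sqrt r != 0 :> R.
  by move=> r0; rewrite gt_eqF// sqrtr_gt0.
rewrite !(normal_pdfE _ (sqrt_neq0 _ v0)) !(normal_pdfE _ (sqrt_neq0 _ w0)).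
rewrite !(normal_pdfE _ (sqrt_neq0 _ vw0)) !(normal_pdfE _ (sqrt_neq0 _ vwd0)).
rewrite /normal_peak /normal_fun.
rewrite (sqr_sqrtr (ltW v0)) (sqr_sqrtr (ltW w0)) (sqr_sqrtr (ltW vw0)).
rewrite (sqr_sqrtr (ltW vwd0)) 2!(mulrACA _ (expR _)) -!expRD -!invfM.
have vwn0 : v + w != 0 by rewrite gt_eqF.
have vn0 : v != 0 by rewrite gt_eqF.
have wn0 : w != 0 by rewrite gt_eqF.
have peak_ge0 r : 0 < r -> 0 <= r * pi *+ 2.
  by move=> r0; rewrite mulrn_wge0// mulr_ge0 ?pi_ge0 ?ltW.
have -> : Num.sqrt (v * pi *+ 2) * Num.sqrt (w * pi *+ 2)
    = Num.sqrt ((v + w) * pi *+ 2) * Num.sqrt (v * w / (v + w) * pi *+ 2).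
  rewrite -!sqrtrM ?peak_ge0//; apply: (congr1 Num.sqrt).
  by rewrite !mulr2n; field.
apply: (congr1 (fun r => _ * expR r)).
by rewrite !mulr2n; field; rewrite !gt_eqF ?addr_gt0 ?mulr_gt0.
Qed.

Lemma measurable_normal_pdf2 s : s != 0 ->
  measurable_fun [set: R * R] (fun z => normal_pdf z.1 s z.2).
Proof.
move=> s0; under eq_fun do rewrite (normal_pdfE _ s0).
apply: measurable_funM => //; apply: measurableT_comp => //.
apply: measurable_funM => //; apply: measurableT_comp => //.
by apply: measurable_funX; exact: measurable_funB.
Qed.

Lemma EFin_gauss_avg v f x : v != 0 -> unit_valued f ->
  (gauss_avg v f x)%:E = (\int[mu]_y (f y * normal_pdf x (Num.sqrt v) y)%:E)%E.
Proof.
move=> v0 uf; rewrite (gauss_avgE _ _ v0) /Rintegral fineK//.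
by apply: integrable_fin_num => //; exact: unit_valued_integrable.
Qed.

Lemma gauss_avg_unit_valued v f : 0 <= v -> unit_valued f ->
  unit_valued (gauss_avg v f).
Proof.
rewrite le0r => /orP[/eqP ->|v_gt0] uf.
  by rewrite (_ : gauss_avg 0 f = f)//; apply/funext => x; rewrite gauss_avg0.
have v0 : v != 0 by rewrite gt_eqF.
have s0 : Num.sqrt v != 0 by rewrite gt_eqF// sqrtr_gt0.
have [mf f01] := uf; split=> [|x].
  apply/measurable_EFinP; rewrite (_ : EFin \o _ = fun x =>
      (\int[mu]_y (f y * normal_pdf x (Num.sqrt v) y)%:E)%E); last first.
    by apply/funext => x; rewrite /= EFin_gauss_avg.
  (* Measurability in the centre [x] is the part of Tonelli's theorem about partial integrals of a
     jointly measurable function. *)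
  apply: (@measurable_fun_fubini_tonelli_F _ _ _ _ _ mu
    (fun z : R * R => (f z.2 * normal_pdf z.1 (Num.sqrt v) z.2)%:E)).
    apply/measurable_EFinP/measurable_funM; first exact: measurableT_comp.
    exact: measurable_normal_pdf2.
  move=> z; rewrite lee_fin mulr_ge0 ?normal_pdf_ge0//.
  by have /andP[] := f01 z.2.
rewrite (gauss_avgE _ _ v0); apply/andP; split.
  apply: Rintegral_ge0 => y _; rewrite mulr_ge0 ?normal_pdf_ge0//.
  by have /andP[] := f01 y.
rewrite -[leRHS](Rintegral_normal_pdf x (Num.sqrt v)).
apply: le_Rintegral => //; first exact: unit_valued_integrable.
  exact: integrable_normal_pdf.
move=> y _; rewrite ler_piMl ?normal_pdf_ge0//.
by have /andP[] := f01 y.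
Qed.

Lemma gauss_avg_semigroup v w f x : 0 <= v -> 0 <= w -> unit_valued f ->
  gauss_avg v (gauss_avg w f) x = gauss_avg (v + w) f x.
Proof.
rewrite le0r => /orP[/eqP ->|v_gt0]; first by rewrite gauss_avg0 add0r.
rewrite le0r => /orP[/eqP ->|w_gt0] uf.
  rewrite addr0; congr (gauss_avg v _ x).
  by apply/funext => y; rewrite gauss_avg0.
have v0 : v != 0 by rewrite gt_eqF.
have w0 : w != 0 by rewrite gt_eqF.
have vw0 : v + w != 0 by rewrite gt_eqF// addr_gt0.
have s0 : Num.sqrt w != 0 by rewrite gt_eqF// sqrtr_gt0.
have [mf f01] := uf.
have ug := gauss_avg_unit_valued (ltW w_gt0) uf.
suff : (gauss_avg v (gauss_avg w f) x)%:E = (gauss_avg (v + w) f x)%:E by case.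
rewrite (EFin_gauss_avg x v0 ug) (EFin_gauss_avg x vw0 uf).
pose F (yz : R * R) := ((f yz.2 * normal_pdf yz.1 (Num.sqrt w) yz.2)
  * normal_pdf x (Num.sqrt v) yz.1)%:E.
transitivity (\int[mu]_y \int[mu]_z
   ((f z * normal_pdf y (Num.sqrt w) z) * normal_pdf x (Num.sqrt v) y)%:E)%E.
  apply: eq_integral => y _; rewrite EFinM (EFin_gauss_avg y w0 uf).
  under [RHS]eq_integral do rewrite EFinM.
  rewrite ge0_integralZr//.
  - apply/measurable_EFinP/measurable_funM => //; exact: measurable_normal_pdf.
  - move=> z _; rewrite lee_fin mulr_ge0 ?normal_pdf_ge0//.
    by have /andP[] := f01 z.
  - by rewrite lee_fin normal_pdf_ge0.
transitivity (\int[mu]_z \int[mu]_y F (y, z))%E.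
  apply: (@fubini_tonelli _ _ _ _ R mu mu F) => [|z].
    apply/measurable_EFinP/measurable_funM; last first.
      by apply: measurableT_comp => //; exact: measurable_normal_pdf.
    apply: measurable_funM; first exact: measurableT_comp.
    exact: measurable_normal_pdf2.
  rewrite lee_fin !mulr_ge0 ?normal_pdf_ge0//.
  by have /andP[] := f01 z.2.
apply: eq_integral => z _; rewrite /F /=.
(* After the exchange the inner variable is [y]; it survives only in the conditional density, whose
   integral is 1. *)
under eq_integral => y _.
  rewrite -mulrA [X in _ * X]mulrC (normal_pdf_convolution _ _ _ v_gt0 w_gt0).
  rewrite mulrA EFinM; over.
rewrite ge0_integralZl//.
- by rewrite integral_normal_pdf mule1.
- by apply/measurable_EFinP; exact: measurable_normal_pdf.
- by move=> y _; rewrite lee_fin normal_pdf_ge0.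
- by rewrite lee_fin mulr_ge0 ?normal_pdf_ge0//; have /andP[] := f01 z.
Qed.

End gauss_avg.

(** * Real-rootedness of the generating function *)

Lemma horner_deriv_prod_XsubC (F : fieldType) (rs : seq F) (z : F) :
  z \notin rs ->
  (\prod_(r <- rs) ('X - r%:P))^`().[z] =
  (\prod_(r <- rs) ('X - r%:P)).[z] * \sum_(r <- rs) (z - r)^-1.
Proof.
elim: rs => [|r rs IH]; first by rewrite !big_nil derivC hornerC mulr0.
rewrite inE negb_or => /andP[zr /IH{}IH].
rewrite !big_cons derivM derivXsubC mul1r hornerD !hornerM IH hornerXsubC.
by field; rewrite subr_eq0.
Qed.

Lemma coef_X1n (A : comNzRingType) n k : (('X + 1 : {poly A}) ^+ n)`_k = 'C(n, k)%:R.
Proof.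
rewrite addrC exprDn coef_sum; under eq_bigr do
  rewrite expr1n mul1r coefMn coefXn.
have [kn|kn] := ltnP k n.+1.
  rewrite (bigD1 (Ordinal kn))//= eqxx big1 ?addr0// => i.
  by rewrite -val_eqE/= eq_sym => /negbTE->; rewrite mul0rn.
rewrite big1 ?bin_small// => i _.
by rewrite gtn_eqF ?mul0rn// (leq_trans _ kn).
Qed.

Section nonpos_rooted.
Context {R : rcfType}.
Implicit Types (p q : {poly R}) (rs : seq R).
Local Notation toC := (real_complex R).

(** The list carries multiplicities, and [c = 0] admits the zero polynomial, which [polar] does
    produce from a monomial of degree [a]. *)
Definition nonpos_rooted p := exists (c : R) rs,
  all (fun r => r <= 0) rs /\ p = c *: \prod_(r <- rs) ('X - r%:P).

Lemma nonpos_rootedZ p (a : R) : nonpos_rooted p -> nonpos_rooted (a *: p).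
Proof. by move=> [c [rs [rs0 ->]]]; exists (a * c), rs; rewrite scalerA. Qed.

(** Every polynomial splits over the algebraically closed [R[i]]; when all the roots found there are
    real, the factorization descends by injectivity of [toC]. *)
Lemma nonpos_rooted_complex p :
  (forall z : R[i], root (map_poly toC p) z -> exists2 r, r <= 0 & z = toC r) ->
  nonpos_rooted p.
Proof.
move=> pz; have [zs pE] := closed_field_poly_normal (map_poly toC p).
have [->|p0] := eqVneq p 0.
  by exists 0, [::]; split=> //; rewrite scale0r.
have zsr z : z \in zs -> exists2 r, r <= 0 & z = toC r.
  move=> zzs; apply: pz; rewrite pE rootZ; last by rewrite lead_coef_map fmorph_eq0 lead_coef_eq0.
  by rewrite root_prod_XsubC.
exists (lead_coef p), (map (@complex.Re R) zs); split.
  by rewrite all_map; apply/allP => z /zsr[r r0 ->].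
apply: (map_poly_inj toC); rewrite pE map_polyZ lead_coef_map; congr (_ *: _).
rewrite rmorph_prod big_map/=; apply: eq_big_seq => z /zsr[r _ ->] /=.
by rewrite rmorphB /= map_polyX map_polyC.
Qed.

(** The polar derivative with pole 0 of a polynomial of formal degree [a]. *)
Definition polar (a : nat) p := a%:R *: p - 'X * p^`().

Lemma coef_polar a p k : (polar a p)`_k = (a%:R - k%:R) * p`_k.
Proof.
rewrite coefB coefZ coefXM; case: k => [|k] /=; first by rewrite !subr0.
by rewrite coef_deriv mulrBl mulr_natl.
Qed.

(** The factor [a - k] kills the coefficient of index [a], so the next application can use [a - 1];
    this is how falling factorials build up. *)
Lemma size_polar a p : (size p <= a.+1)%N -> (size (polar a p) <= a)%N.
Proof.
move=> pa; apply/leq_sizeP => k; rewrite leq_eqVlt coef_polar => /predU1P[->|ak].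
  by rewrite subrr mul0r.
by rewrite (leq_sizeP _ _ pa) ?mulr0.
Qed.

(* A root [z] of [polar a p] outside [(-oo, 0]] satisfies
   [a = \sum_r z / (z - r)], but each summand has an imaginary part of the sign
   of that of [z], or is a real number in ]0, 1]. *)
Lemma polar_nonpos_rooted a p :
  (size p <= a.+1)%N -> nonpos_rooted p -> nonpos_rooted (polar a p).
Proof.
move=> pa [c [rs [rs0 pE]]].
have [c0|c0] := eqVneq c 0.
  exists 0, [::]; split=> //.
  by rewrite /polar pE c0 !scale0r derivC mulr0 scaler0 subrr.
(* A nonzero root [r1] is what makes the inequalities below strict. Without one, [p] is a monomial
   and [polar] only rescales it. *)
have [/allP rsz|/allPn[r1 r1rs r1z]] := boolP (all (fun r => r == 0) rs).
  exists ((a%:R - (size rs)%:R) * c), rs; split=> //.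
  have prodE : \prod_(r <- rs) ('X - r%:P) = 'X^(size rs).
    rewrite (eq_big_seq (fun=> 'X)); last by move=> r /rsz/eqP->; rewrite subr0.
    by rewrite big_const_seq count_predT iter_mulr_1.
  apply/polyP => k; rewrite coef_polar pE prodE !coefZ coefXn.
  by case: eqP => [->|_]; rewrite ?mulr0// !mulrA.
apply: nonpos_rooted_complex => z rz.
have srs : (size rs <= a)%N.
  by move: pa; rewrite pE size_scale// size_prod_XsubC.
have [zneg|zneg] := boolP ((complex.Im z == 0) && (complex.Re z <= 0)).
  case: z zneg {rz} => x y /= /andP[/eqP -> x0]; by exists x.
exfalso.
have zr r : r \in rs -> z != toC r.
  move=> rrs; apply: contra zneg => /eqP->/=; rewrite eqxx/=.
  exact: (allP rs0).
have pzE : map_poly toC p = toC c *: \prod_(r <- map toC rs) ('X - r%:P).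
  rewrite pE map_polyZ rmorph_prod big_map/=; congr (_ *: _).
  by apply: eq_bigr => r _; rewrite rmorphB /= map_polyX map_polyC.
have znrs : z \notin map toC rs.
  by apply/mapP => -[r /zr]/eqP.
have /eqP sumE : \sum_(r <- rs) z / (z - toC r) == a%:R.
  move: rz; rewrite /root /polar rmorphB rmorphM/= map_polyZ map_polyX -deriv_map.
  rewrite pzE derivZ hornerD hornerN hornerM hornerX !hornerZ.
  rewrite horner_deriv_prod_XsubC// rmorph_nat.
  set q := (\prod_(_ <- _) _).[z]; rewrite big_map; set s := \sum_(_ <- _) _.
  have -> : a%:R * (toC c * q) - z * (toC c * (q * s)) = toC c * q * (a%:R - z * s).
    by ring.
  rewrite mulf_eq0 mulf_eq0 fmorph_eq0 (negbTE c0)/=.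
  rewrite -[q == 0]/(root _ _) root_prod_XsubC (negbTE znrs) /= subr_eq0 eq_sym.
  by rewrite /s mulr_sumr.
case: z sumE zr zneg {rz znrs} => x y sumE zr zneg.
pose nrm r := (x - r) ^+ 2 + y ^+ 2.
have nrm_gt0 r : r \in rs -> 0 < nrm r.
  move=> /zr; rewrite eq_complex/= negb_and /nrm => h.
  rewrite lt0r addr_ge0 ?sqr_ge0// andbT paddr_eq0 ?sqr_ge0// !sqrf_eq0.
  by rewrite subr_eq0 negb_and.
have summandE r : r \in rs -> (x +i* y)%C / ((x +i* y)%C - toC r) =
    ((x * (x - r) + y ^+ 2) / nrm r +i* (- (r * y) / nrm r))%C.
  move=> rrs; have /lt0r_neq0 := nrm_gt0 _ rrs; rewrite /nrm => nr.
  apply: (canLR (mulfK _)); first by rewrite subr_eq0 zr.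
  by apply/eqP; rewrite eq_complex/=; apply/andP; split; apply/eqP; field.
have sumC (F G : R -> R) (s : seq R) : \sum_(r <- s) (F r +i* G r)%C =
    ((\sum_(r <- s) F r) +i* (\sum_(r <- s) G r))%C.
  by elim: s => [|r s IH]; rewrite ?big_nil// !big_cons IH.
have := sumE; rewrite (eq_big_seq _ summandE) sumC.
rewrite -(rmorph_nat toC) => -[Re_sum Im_sum].
have [r1neg nr1] : r1 < 0 /\ 0 < nrm r1.
  by split; [rewrite lt_neqAle r1z (allP rs0)|exact: nrm_gt0].
(* For real [z > 0] the summands are at most 1, strictly at [r1], so their sum stays below the
   number of roots, hence below [a]. *)
have [y0|y0] := eqVneq y 0.
  have x0 : 0 < x by move: zneg; rewrite /= y0 eqxx/= -ltNge.
  have le1 r : r \in rs -> (x * (x - r) + y ^+ 2) / nrm r <= 1.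
    move=> rrs; have /= r0 := allP rs0 _ rrs.
    rewrite ler_pdivrMr ?nrm_gt0// mul1r /nrm y0; nra.
  have : \sum_(r <- rs) ((x * (x - r) + y ^+ 2) / nrm r) < (size rs)%:R.
    rewrite -sum1_size natr_sum (big_rem r1)//= [ltRHS](big_rem r1)//=.
    apply: ltr_leD.
      by rewrite ltr_pdivrMr// mul1r /nrm y0; nra.
    by rewrite !big_seq; apply: ler_sum => r /mem_rem/le1.
  by rewrite Re_sum ltr_nat ltnNge srs.
(* Multiplying the imaginary parts by [y] makes all of them nonnegative, whatever the sign of
   [y]. *)
have : \sum_(r <- rs) (y * (- (r * y) / nrm r)) == 0.
  by rewrite -mulr_sumr Im_sum mulr0.
have ge0 r : r \in rs -> 0 <= y * (- (r * y) / nrm r).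
  move=> rrs; have /= r0 := allP rs0 _ rrs.
  rewrite mulrA divr_ge0 ?(ltW (nrm_gt0 _ rrs))//.
  by rewrite (_ : y * _ = - r * y ^+ 2); [rewrite mulr_ge0 ?oppr_ge0 ?sqr_ge0|ring].
rewrite (big_rem r1)//= gt_eqF// ltr_wpDr//.
  by rewrite big_seq sumr_ge0// => r /mem_rem/ge0.
rewrite mulrA divr_gt0// (_ : y * _ = - r1 * y ^+ 2); last by ring.
by rewrite mulr_gt0 ?oppr_gt0// exprn_even_gt0.
Qed.

Lemma nonpos_rooted_ffact n m p : (m <= n)%N -> (size p <= n.+1)%N ->
  nonpos_rooted p ->
  exists q, [/\ nonpos_rooted q, (size q <= (n - m).+1)%N
    & forall k, (k <= n)%N -> q`_k = ((n - k) ^_ m)%:R * p`_k].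
Proof.
move=> + pn pr; elim: m => [_|m IH mn].
  by exists p; rewrite subn0; split=> // k _; rewrite ffactn0 mul1r.
have [q [qr sq qE]] := IH (ltnW mn).
exists (polar (n - m) q); split.
- exact: polar_nonpos_rooted.
- by rewrite -subSn// subSS; apply: size_polar.
move=> k kn; rewrite coef_polar qE// ffactnSr natrM mulrA; congr (_ * _).
(* When [n - k < m] the real factor is negative and the truncated one is 0, but the falling
   factorial in front already vanishes. *)
rewrite mulrC; have [mk|mk] := leqP m (n - k).
  by rewrite (natrB _ mk) (natrB _ kn) (natrB _ (ltnW mn)); ring.
by rewrite ffact_small// !mul0r.
Qed.

Lemma nonpos_rooted_bin n m p : (m <= n)%N -> (size p <= n.+1)%N ->
  nonpos_rooted p -> nonpos_rooted (\poly_(k < n.+1) ('C(n - k, m)%:R * p`_k)).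
Proof.
move=> mn pn pr; have [q [qr sq qE]] := nonpos_rooted_ffact mn pn pr.
rewrite (_ : \poly_(_ < _) _ = (m`!%:R)^-1 *: q); first exact: nonpos_rootedZ.
apply/polyP => k; rewrite coef_poly coefZ ltnS; case: leqP => kn.
  rewrite qE// -bin_ffact natrM; field.
  by rewrite pnatr_eq0 -lt0n fact_gt0.
by rewrite (leq_sizeP _ _ sq) ?mulr0// (leq_ltn_trans (leq_subr m n)).
Qed.

Lemma nonpos_rooted_prod_bin n (l : seq nat) : all (fun m => m <= n)%N l ->
  nonpos_rooted (\poly_(k < n.+1) ('C(n, k)%:R * \prod_(m <- l) 'C(n - k, m)%:R)).
Proof.
elim: l => [_|m l IH /= /andP[mn /IH{}IH]].
  exists 1, (nseq n (-1)); split; first by rewrite all_nseq lerN10 orbT.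
  rewrite scale1r big_nseq iter_mulr_1 polyCN opprK.
  apply/polyP => k; rewrite coef_poly big_nil mulr1 ltnS.
  by rewrite coef_X1n; case: ltnP => // kn; rewrite bin_small.
have := nonpos_rooted_bin mn _ IH; rewrite size_poly => /(_ isT).
congr nonpos_rooted; apply/polyP => k; rewrite !coef_poly.
by case: ltnP => // kn; rewrite big_cons mulrCA.
Qed.

End nonpos_rooted.

(** * Generating functions of sums of Bernoulli variables *)

Section bernoulli.
Context {R : rcfType}.
Implicit Types (ps : seq R) (q : {poly R}).

(** The coefficients of E (1 + X)^Y are factorial moments divided by k!; these are the ones that
    determine mean and variance. The last identity is Newton's, for the second elementary symmetric
    polynomial. *)
Lemma coef_prod_1pX ps (P := \prod_(p <- ps) (1 + p *: 'X)) :
  [/\ P`_0 = 1, P`_1 = \sum_(p <- ps) p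
    & 2 * P`_2 = (\sum_(p <- ps) p) ^+ 2 - \sum_(p <- ps) p ^+ 2].
Proof.
rewrite /P {P}; elim: ps => [|p ps [IH0 IH1 IH2]].
  by rewrite !big_nil !coef1 expr0n !mulr0 subrr.
rewrite !big_cons mulrDl mul1r -scalerAl !coefD !coefZ !coefXM /= IH0 IH1.
by split; [ring|ring|rewrite mulrDr IH2; ring].
Qed.

Definition bernoulli_pgf ps := \prod_(p <- ps) ((1 - p)%:P + p *: 'X).

Lemma size_bernoulli_pgf ps : (size (bernoulli_pgf ps) <= (size ps).+1)%N.
Proof.
rewrite /bernoulli_pgf; elim: ps => [|p ps IH].
  by rewrite big_nil size_poly1.
have factor_size : (size ((1 - p)%:P + p *: 'X : {poly R})%R <= 2)%N.
  rewrite (leq_trans (size_polyD _ _))// geq_max (leq_trans (size_polyC_leq1 _))//=.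
  by rewrite (leq_trans (size_scale_leq _ _))// size_polyX.
rewrite big_cons (leq_trans (size_polyMleq _ _))//.
by have := leq_add factor_size IH; case: (_ + _)%N.
Qed.

Lemma bernoulli_pgfX1 ps :
  bernoulli_pgf ps \Po ('X + 1) = \prod_(p <- ps) (1 + p *: 'X).
Proof.
rewrite /bernoulli_pgf rmorph_prod; apply: eq_bigr => p _ /=.
rewrite comp_polyD comp_polyC comp_polyZ comp_polyX polyCB -!mul_polyC.
by ring.
Qed.

(** The hypothesis only places the roots [1 + r] of [q] below 1; nonnegative coefficients exclude
    those in ]0, 1]. A factor [X - (1 + r)] with [r <= -1], divided by its value [- r] at 1, is the
    generating function of a Bernoulli variable of parameter [-1/r]. *)
Lemma bernoulli_pgf_of_nonpos_rooted q : (forall k, 0 <= q`_k) -> q.[1] = 1 ->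
  nonpos_rooted (q \Po ('X + 1)) ->
  exists2 ps, all (fun p => 0 <= p <= 1) ps & q = bernoulli_pgf ps.
Proof.
move=> q0 q1 [c [rs [rs0]]].
move=> /(congr1 (fun s : {poly R} => s \Po ('X - 1))).
rewrite -comp_polyA comp_polyD comp_polyX -[1 in X in _ \Po (_ + X)]polyC1.
rewrite comp_polyC polyC1 subrK comp_polyXr comp_polyZ rmorph_prod/=.
under eq_bigr do rewrite comp_polyB comp_polyX comp_polyC -polyC1 -addrA -opprD -polyCD.
move=> qE.
have c0 : c != 0.
  by apply: contra_eqN q1 => /eqP c0; rewrite qE c0 scale0r horner0 eq_sym oner_eq0.
have rsN1 r : r \in rs -> r <= -1.
  move=> rrs; rewrite leNgt; apply/negP => r1.
  have : q.[1 + r] = 0.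
    by rewrite qE hornerZ (big_rem r)//= hornerM hornerXsubC subrr mul0r mulr0.
  rewrite horner_coef => /eqP; rewrite psumr_eq0; last first.
    by move=> i _; rewrite mulr_ge0 ?exprn_ge0//; lra.
  move=> /allP qz; have : q == 0.
    apply/eqP/polyP => k; rewrite coef0.
    have [kq|kq] := ltnP k (size q); last by rewrite (leq_sizeP _ _ kq).
    have := qz (Ordinal kq); rewrite mem_index_enum => /(_ isT)/=.
    by rewrite mulf_eq0 expf_eq0 => /orP[/eqP//|/andP[_]]; rewrite gt_eqF//; lra.
  by apply/negP; apply: contra_eqN q1 => /eqP->; rewrite horner0 eq_sym oner_eq0.
exists (map (fun r => (- r)^-1) rs).
  rewrite all_map; apply/allP => r /rsN1 r1 /=.
  rewrite invr_ge0 invf_le1; lra.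
have prodE : c * \prod_(r <- rs) - r = 1.
  rewrite -[RHS]q1 qE hornerZ horner_prod; congr (_ * _).
  by apply: eq_bigr => r _; rewrite hornerXsubC; ring.
rewrite qE /bernoulli_pgf big_map.
rewrite [RHS](eq_big_seq (fun r => (- r)^-1 *: ('X - (1 + r)%:P))); last first.
  move=> r /rsN1 r1; rewrite scalerBr -!mul_polyC -polyCM.
  have -> : (- r)^-1 * (1 + r) = (- r)^-1 - 1 by field; rewrite lt_eqF//; lra.
  move: (- r)^-1 => u; rewrite !polyCB polyC1; ring.
rewrite scaler_prod; congr (_ *: _).
rewrite prodfV; apply: (mulIf (x := \prod_(r <- rs) - r)).
  by apply/eqP => P0; move: prodE; rewrite P0 mulr0 => /eqP; rewrite eq_sym oner_eq0.
rewrite prodE mulVf//.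
by apply/eqP => P0; move: prodE; rewrite P0 mulr0 => /eqP; rewrite eq_sym oner_eq0.
Qed.

End bernoulli.

(* The probability that independent uniform subsets of sizes [m i] of an
   [n]-element set all avoid a fixed [k]-element set. *)
Definition avoid_prob (R : unitRingType) n l (m : 'I_l -> nat) k : R :=
  \prod_(i < l) ('C(n - k, m i)%:R / 'C(n, m i)%:R).

Section set_pgf.
Context {R : rcfType} (n l : nat) (m : 'I_l -> nat) (w : {set 'I_n} -> R).
Hypothesis w_ge0 : forall U, 0 <= w U.
Hypothesis m_le : forall i, (m i <= n)%N.
Local Notation a := (avoid_prob R n m).
Hypothesis wE : forall K : {set 'I_n}, \sum_(U : {set 'I_n} | K \subset U) w U = a #|K|.

Let q : {poly R} := \sum_(U : {set 'I_n}) w U *: 'X^#|U|.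

(** Double counting of the pairs [K \subset U] with [#|K| = k], weighted by [w U]. *)
Lemma set_pgfX1E k : (q \Po ('X + 1))`_k = 'C(n, k)%:R * a k.
Proof.
rewrite /q rmorph_sum coef_sum/=.
under eq_bigr => U _.
  rewrite comp_polyZ rmorphXn/= comp_polyX coefZ coef_X1n -cards_draws.
  rewrite -sum1_card natr_sum mulr_sumr big_mkcond/=.
  under eq_bigr do rewrite mulr1 inE.
  over.
rewrite exchange_big/=.
have -> : 'C(n, k)%:R * a k = \sum_(K : {set 'I_n} | #|K| == k) a k.
  have := cards_draws [set: 'I_n]%SET k; rewrite cardsT card_ord => <-.
  rewrite sumr_const mulr_natl; congr (_ *+ _).
  by apply: eq_card => K; rewrite !inE finset.subsetT.
rewrite [RHS]big_mkcond/=; apply: eq_bigr => K _.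
have [<-|Kk] := eqVneq #|K| k; last by rewrite big1// => U _; rewrite andbF.
by rewrite -wE [RHS]big_mkcond/=; apply: eq_bigr => U _; rewrite andbT.
Qed.

(** The last two equations are the mean and E Y(Y - 1); they give the variance [\sum p (1 - p)]
    without access to the individual parameters. *)
Lemma set_pgf_bernoulli : exists ps, [/\ all (fun p => 0 <= p <= 1) ps,
  q = bernoulli_pgf ps, \sum_(p <- ps) p = n%:R * a 1
  & (\sum_(p <- ps) p) ^+ 2 - \sum_(p <- ps) p ^+ 2
    = n%:R * (n%:R - 1) * a 2].
Proof.
have a0 : a 0 = 1.
  by rewrite /avoid_prob big1// => i _; rewrite subn0 divff// pnatr_eq0 -lt0n bin_gt0.
have [|||ps ps01 qE] := @bernoulli_pgf_of_nonpos_rooted _ q.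
- move=> k; rewrite coef_sum sumr_ge0// => U _.
  by rewrite coefZ coefXn mulr_ge0.
- rewrite horner_sum -[RHS]a0 -(finset.cards0 'I_n) -wE.
  rewrite [RHS](eq_bigl xpredT); last by move=> U; rewrite finset.sub0set.
  by apply: eq_bigr => U _; rewrite hornerZ hornerXn expr1n mulr1.
- have [l' l'E] : exists l' : seq nat, l' = map m (index_enum 'I_l) by eexists.
  have /nonpos_rooted_prod_bin : all (fun k => k <= n)%N l'.
    by rewrite l'E all_map; apply/allP => i _ /=.
  move=> /(_ R)/(nonpos_rootedZ (\prod_(i < l) ('C(n, m i)%:R)^-1)).
  congr nonpos_rooted; apply/polyP => k.
  rewrite coefZ coef_poly set_pgfX1E; case: ltnP => [kn|kn]; last first.
    by rewrite bin_small// mul0r mulr0.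
  by rewrite l'E big_map mulrCA -big_split/=; congr (_ * _); apply: eq_bigr => i _; rewrite mulrC.
exists ps; have [_ c1 c2] := coef_prod_1pX ps.
rewrite -c2 -c1 -bernoulli_pgfX1 -qE !set_pgfX1E bin1; split=> //.
rewrite mulrA; congr (_ * _).
case: (n) => [|N]; first by rewrite bin0n mulr0 mul0r.
rewrite -natrM -mul_bin_diag bin1 natrM; congr (_ * _).
by rewrite -natr1 addrK.
Qed.

End set_pgf.

(** * The law of the set of uncovered points *)

Lemma measure_fin_preimage d (T : measurableType d) (R : realType)
    (P : probability T R) (F : finType) (V : T -> F) (Q : pred F) :
  (forall u, measurable (V @^-1` [set u])) ->
  P (V @^-1` [set u | Q u]) = (\sum_(u | Q u) P (V @^-1` [set u]))%E.
Proof.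
move=> mV; rewrite -big_filter fsbig_seq ?filter_uniq ?index_enum_uniq//.
rewrite -measure_fin_bigcup//; last first.
  by move=> u v _ _ [w [/= -> ->]].
congr (P _); apply/seteqP; split => [w /= Qw|w [u /=]].
  by exists (V w) => //=; rewrite mem_filter Qw mem_index_enum.
by rewrite mem_filter => /andP[Qu _] ->.
Qed.

Section uncovered_law.
Context d (T : measurableType d) (R : realType) (P : probability T R).
Context (n l : nat) (A : 'I_l -> {RV P >-> {set 'I_n}}) (m : 'I_l -> nat).
Hypothesis A_indep : mutually_independent A.
Hypothesis A_unif : forall i,
  uniform_in (A i) [set S : {set 'I_n} | #|S| == m i]%SET.
Implicit Types (K U : {set 'I_n}).

Definition uncovered_set w : {set 'I_n} := (~: \bigcup_(i < l) A i w)%SET.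

Lemma uncoveredE w : uncovered A w = #|uncovered_set w|%:R.
Proof.
rewrite /uncovered_set finset.cardsCs finset.setCK card_ord natrB//.
by rewrite -[leqRHS]card_ord max_card.
Qed.

Lemma subset_uncovered_setE K :
  [set w | K \subset uncovered_set w] =
  \bigcap_(i in [set` [set: 'I_l]%SET]) (A i @^-1` [set S : {set 'I_n} | S \subset (~: K)%SET]).
Proof.
apply/seteqP; split=> [w /= Kw i _ /=|w /= Kw].
  rewrite finset.subsetC (fintype.subset_trans Kw)//.
  by rewrite /uncovered_set finset.setCS finset.bigcup_sup.
rewrite /uncovered_set finset.subsetC; apply/finset.bigcupsP => i _.
by apply: (Kw i); rewrite /= inE.
Qed.

Lemma measurable_subset_uncovered_set K :
  measurable [set w | K \subset uncovered_set w].
Proof.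
rewrite subset_uncovered_setE; apply: fin_bigcap_measurable => // i _.
exact: measurable_sfunP.
Qed.

(** Only superset events are intersections of events about the single [A i]. The exact value [U] is
    the superset event of [U] minus those of all [x |: U] with [x] outside [U]. *)
Lemma measurable_uncovered_set U : measurable (uncovered_set @^-1` [set U]).
Proof.
rewrite (_ : _ @^-1` _ = [set w | U \subset uncovered_set w] `\`
    \bigcup_(x in [set` ~: U]%SET) [set w | (x |: U)%SET \subset uncovered_set w]).
  apply: measurableD; first exact: measurable_subset_uncovered_set.
  apply: fin_bigcup_measurable => // x _.
  exact: measurable_subset_uncovered_set.
apply/seteqP; split=> [w /= <-|w /= [Uw /= nw]].
  split=> // -[x /=]; rewrite finset.in_setC => /negP xU.
  by rewrite finset.subUset finset.sub1set => /andP[].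
apply/eqP; rewrite finset.eqEsubset Uw andbT; apply/fintype.subsetP => x xw.
apply: contrapT => /negP xU; apply: nw; exists x => /=.
  by rewrite finset.in_setC.
by rewrite finset.subUset finset.sub1set xw Uw.
Qed.

Definition uncovered_law U : R := fine (P (uncovered_set @^-1` [set U])).

Lemma EFin_uncovered_law U : (uncovered_law U)%:E = P (uncovered_set @^-1` [set U]).
Proof. by rewrite fineK// fin_num_measure//; exact: measurable_uncovered_set. Qed.

Lemma uncovered_law_ge0 U : 0 <= uncovered_law U.
Proof. exact: fine_ge0. Qed.

Lemma sum_uncovered_law (Q : pred {set 'I_n}) :
  (\sum_(U | Q U) uncovered_law U)%:E = P [set w | Q (uncovered_set w)].
Proof.
rewrite -sumEFin -[RHS]/(P (uncovered_set @^-1` [set U | Q U])).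
rewrite measure_fin_preimage; last exact: measurable_uncovered_set.
by apply: eq_bigr => U _; rewrite EFin_uncovered_law.
Qed.

Lemma probability_subsetC i K :
  P (A i @^-1` [set S : {set 'I_n} | S \subset (~: K)%SET]) =
  ('C(n - #|K|, m i)%:R / 'C(n, m i)%:R)%:E.
Proof.
rewrite measure_fin_preimage; last by move=> S; exact: measurable_sfunP.
under eq_bigr do rewrite A_unif.
have -> : #|[set S : {set 'I_n} | #|S| == m i]%SET| = 'C(n, m i).
  have := cards_draws [set: 'I_n]%SET (m i); rewrite cardsT card_ord => <-.
  by apply: eq_card => S; rewrite !inE finset.subsetT.
have -> : (n - #|K|)%N = #|(~: K)%SET|.
  by rewrite [RHS]finset.cardsCs finset.setCK card_ord.
rewrite -cards_draws sumEFin -sum1_card natr_sum mulr_suml; congr (_%:E).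
rewrite big_mkcond [RHS]big_mkcond/=; apply: eq_bigr => S _.
rewrite !inE.
by case: ifP => // _; case: ifP => //; rewrite mul1r.
Qed.

Lemma sum_uncovered_law_subset K :
  \sum_(U : {set 'I_n} | K \subset U) uncovered_law U = avoid_prob R n m #|K|.
Proof.
apply: EFin_inj; rewrite sum_uncovered_law subset_uncovered_setE.
rewrite A_indep => [|i _]; last by [].
rewrite -prodEFin big_mkcond/=; apply: eq_bigr => i _.
by rewrite inE probability_subsetC.
Qed.

Lemma cdf_standardize_uncovered (mu sigma x : R) :
  cdf (standardize (uncovered A) mu sigma) x =
  (\sum_(U : {set 'I_n} | (#|U|%:R - mu) / sigma <= x) uncovered_law U)%:E.
Proof.
rewrite (sum_uncovered_law (fun U => (#|U|%:R - mu) / sigma <= x)) /cdf.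
congr (P _); apply/seteqP; split=> w /=;
  by rewrite in_itv/= /standardize/= /standardize_fun uncoveredE.
Qed.

End uncovered_law.

(** * Lindeberg's replacement *)

Section lindeberg.
Context {R : realType}.
Implicit Types (f g : R -> R) (x y u t s v M p dl : R) (ps : seq R).
Notation mu := (@lebesgue_measure R).

Lemma sinh_taylor u :
  `|(expR u - expR (- u)) / 2 - u| <= `|u| ^+ 3 * expR `|u|.
Proof.
have := expR_taylor2 u; have := expR_taylor2 (- u); rewrite normrN sqrrN.
by set E := _ * expR _; rewrite !ler_norml => /andP[? ?] /andP[? ?]; lra.
Qed.

Lemma cosh_taylor u :
  `|(expR u + expR (- u)) / 2 - 1 - u ^+ 2 / 2| <= `|u| ^+ 3 * expR `|u|.
Proof.
have := expR_taylor2 u; have := expR_taylor2 (- u); rewrite normrN sqrrN.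
by set E := _ * expR _; rewrite !ler_norml => /andP[? ?] /andP[? ?]; lra.
Qed.

(** The series bound [z^3 / 6 <= exp z] at [z = |u| / s] trades the cube for [s^3] and an
    exponential, and [exp |y| <= exp y + exp (- y)] removes the absolute value. With [s] the
    standard deviation the resulting moments are bounded. *)
Lemma norm3_expR_le u s : 0 < s ->
  `|u| ^+ 3 * expR `|u| <=
  6 * s ^+ 3 * (expR ((1 + s^-1) * u) + expR (- (1 + s^-1) * u)).
Proof.
move=> s0.
have h : `|u| ^+ 3 <= 6 * s ^+ 3 * expR (s^-1 * `|u|).
  have su0 : 0 <= s^-1 * `|u| by rewrite mulr_ge0// invr_ge0 ltW.
  have := expR_ge1Dxn 2 su0; rewrite exprMn exprVn !factS fact0 !mulnE/= => h.
  have {}h : (s ^+ 3)^-1 * `|u| ^+ 3 / 6 <= expR (s^-1 * `|u|) by lra.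
  rewrite (_ : `|u| ^+ 3 = 6 * s ^+ 3 * ((s ^+ 3)^-1 * `|u| ^+ 3 / 6)).
    by rewrite ler_wpM2l// mulr_ge0 ?exprn_ge0 ?ltW.
  by move: (`|u| ^+ 3) => u3; field; rewrite gt_eqF.
apply: (@le_trans _ _ (6 * s ^+ 3 * expR ((1 + s^-1) * `|u|))).
  have -> : expR ((1 + s^-1) * `|u|) = expR (s^-1 * `|u|) * expR `|u|.
    by rewrite -expRD; congr expR; ring.
  by rewrite mulrA ler_wpM2r ?expR_ge0.
rewrite ler_wpM2l//; first by rewrite mulr_ge0 ?exprn_ge0 ?ltW.
have [u0|u0] := ger0P u; first by rewrite lerDl expR_ge0.
by rewrite mulrN mulNr lerDr expR_ge0.
Qed.

(* Expanding in [sinh u] and [cosh u - 1] instead of [u] and [u ^+ 2 / 2] leaves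
   only exponential moments of the Gaussian, obtained by completing the square. *)
Lemma gauss_avg_taylor f x (a b : R) M v : 0 < v <= 1 -> unit_valued f ->
  `|a| <= M -> `|b| <= M ->
  (forall u, `|f (x + u) - f x - a * u - b * u ^+ 2 / 2| <= M * `|u| ^+ 3) ->
  `|gauss_avg v f x - f x - b * v / 2| <= 37 * expR 2 * M * v * Num.sqrt v.
Proof.
move=> /andP[v0 v1] uf aM bM taylor.
have vn0 : v != 0 by rewrite gt_eqF.
have sgt0 : 0 < Num.sqrt v by rewrite sqrtr_gt0.
have sv : Num.sqrt v ^+ 2 = v by rewrite sqr_sqrtr// ltW.
have sle1 : Num.sqrt v <= 1 by rewrite -sqrtr1 ler_sqrt.
have vsE : v * Num.sqrt v = Num.sqrt v ^+ 3 by rewrite exprSr sv.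
set s := Num.sqrt v in sgt0 sv sle1 vsE *.
have M0 : 0 <= M by exact: le_trans aM.
have sn0 : s != 0 by rewrite gt_eqF.
pose e t y := expR (t * (y - x)) * normal_pdf x s y.
have ie t : mu.-integrable setT (fun y => (e t y)%:E).
  exact: integrable_expR_normal_pdf.
have i1 := @integrable_normal_pdf R x s.
have Ee t : (\int[mu]_y e t y)%R = expR (t ^+ 2 * v / 2).
  by rewrite Rintegral_expR_normal_pdf// sv.
(* With [u = y - x], this is [f y - f x - a sinh u - b (cosh u - 1)] times the density, regrouped by
   exponentials. *)
pose D y := f y * normal_pdf x s y + ((b - f x) * normal_pdf x s y
  + (- ((a + b) / 2) * e 1 y + ((a - b) / 2) * e (-1) y)).
have iD2 := integrable_add (integrable_scale (- ((a + b) / 2)) (ie 1))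
  (integrable_scale ((a - b) / 2) (ie (-1))).
have iD1 := integrable_add (integrable_scale (b - f x) i1) iD2.
have ID : mu.-integrable setT (fun y => (D y)%:E).
  exact: integrable_add (unit_valued_integrable x s uf) iD1.
have DE : (\int[mu]_y D y)%R = gauss_avg v f x - f x - b * (expR (v / 2) - 1).
  rewrite /D RintegralD//; last exact: unit_valued_integrable.
  rewrite RintegralD//; last exact: integrable_scale.
  rewrite RintegralD//; try exact: integrable_scale.
  rewrite !RintegralZl//; try exact: ie.
  transitivity (gauss_avg v f x + ((b - f x) * 1
      + (- ((a + b) / 2) * expR (1 ^+ 2 * v / 2)
        + (a - b) / 2 * expR ((- 1) ^+ 2 * v / 2)))).
    rewrite (gauss_avgE _ _ vn0); congr (_ + (_ * _ + (_ * _ + _ * _))).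
    - exact: Rintegral_normal_pdf.
    - exact: Ee.
    - exact: Ee.
  by rewrite sqrrN expr1n !mul1r; field.
pose t := 1 + s^-1.
have Dle : `|\int[mu]_y D y|%R <= 36 * expR 2 * M * s ^+ 3.
  apply: (@le_trans _ _ (\int[mu]_y `|D y|)%R); first exact: le_normr_Rintegral.
  (* 18 = 3 * 6: three remainders, of [f], sinh and cosh, and the 6 of [norm3_expR_le]. The two
     exponentials turn it into 36. *)
  pose K := 18 * M * s ^+ 3.
  have K0 : 0 <= K by rewrite /K mulr_ge0 ?exprn_ge0 ?(ltW sgt0)// mulr_ge0.
  have iK := integrable_add (integrable_scale K (ie t)) (integrable_scale K (ie (- t))).
  apply: (@le_trans _ _ (\int[mu]_y (K * e t y + K * e (- t) y))%R).
    apply: le_Rintegral => //; first exact: integrable_norm.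
    move=> y _; rewrite -mulrDr /e -mulrDl mulrA.
    pose u := y - x; rewrite -/u.
    have -> : D y = (f (x + u) - f x - a * ((expR u - expR (- u)) / 2)
        - b * ((expR u + expR (- u)) / 2 - 1)) * normal_pdf x s y.
      by rewrite /D /e /u mul1r mulN1r subrKC; field.
    rewrite normrM (ger0_norm (normal_pdf_ge0 _ _ _)) ler_wpM2r ?normal_pdf_ge0//.
    apply: (@le_trans _ _ (3 * M * (`|u| ^+ 3 * expR `|u|))); last first.
      rewrite /K [leRHS](_ : _ = 3 * M * (6 * s ^+ 3 *
         (expR (t * u) + expR (- t * u)))); last by ring.
      by rewrite ler_wpM2l ?norm3_expR_le// mulr_ge0.
    set E := _ * expR _.
    have u3E : `|u| ^+ 3 <= E.
      by rewrite /E ler_peMr ?exprn_ge0// -expR0 ler_expR.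
    have E0 : 0 <= E by rewrite mulr_ge0 ?exprn_ge0 ?expR_ge0.
    rewrite (_ : f (x + u) - _ - _ - _ = (f (x + u) - f x - a * u - b * u ^+ 2 / 2)
        + (- a * ((expR u - expR (- u)) / 2 - u)
          + - b * ((expR u + expR (- u)) / 2 - 1 - u ^+ 2 / 2))); last by field.
    rewrite (_ : 3 * M * E = M * E + (M * E + M * E)); last by ring.
    apply: (le_trans (ler_normD _ _)); apply: lerD.
      by rewrite (le_trans (taylor u))// ler_wpM2l.
    apply: (le_trans (ler_normD _ _)); rewrite !normrM !normrN.
    by apply: lerD; apply: ler_pM => //; [exact: sinh_taylor|exact: cosh_taylor].
  rewrite RintegralD//; try exact: integrable_scale.
  rewrite !RintegralZl//; try exact: ie.
  apply: (@le_trans _ _ (K * expR (t ^+ 2 * v / 2) + K * expR ((- t) ^+ 2 * v / 2))).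
    by rewrite le_eqVlt; apply/orP; left; apply/eqP; congr (_ * _ + _ * _); exact: Ee.
  rewrite sqrrN.
  (* Here [t^2 v = (1 + s)^2 <= 4]. *)
  have te : expR (t ^+ 2 * v / 2) <= expR 2.
    rewrite ler_expR -sv -exprMn /t mulrDl mul1r mulVf//.
    have := sgt0; have := sle1; nra.
  rewrite -mulrDr [leRHS](_ : _ = K * (expR 2 + expR 2)); last by rewrite /K; ring.
  by rewrite ler_wpM2l// lerD.
move: Dle; rewrite DE => Dle.
(* The mean of cosh u - 1 is [exp (v / 2) - 1] instead of [v / 2]; the difference is of order
   [v^2 <= s^3] and raises 36 to 37. *)
have exp_le : `|b * (expR (v / 2) - 1 - v / 2)| <= expR 2 * M * s ^+ 3.
  rewrite normrM mulrAC [leRHS]mulrC; apply: ler_pM => //.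
  have := expR_taylor2 (v / 2); rewrite (ger0_norm (x := v / 2)); last by lra.
  have ev : expR (v / 2) <= expR 2 by rewrite ler_expR; lra.
  have e2 : 1 <= expR 2 :> R by rewrite -expR0 ler_expR.
  have vs : v <= s by rewrite -[leLHS]sv; nra.
  have vv : v ^+ 2 <= s ^+ 3 by rewrite -vsE; nra.
  have v3 : (v / 2) ^+ 3 <= s ^+ 3 / 2 by apply: (@le_trans _ _ (v ^+ 2 / 2)); [nra|lra].
  have s3 : 0 <= s ^+ 3 by rewrite exprn_ge0// ltW.
  have h3 : (v / 2) ^+ 3 * expR (v / 2) <= s ^+ 3 / 2 * expR 2.
    by apply: ler_pM => //; rewrite ?exprn_ge0 ?expR_ge0//; lra.
  have h4 : s ^+ 3 <= s ^+ 3 * expR 2 by rewrite ler_peMr.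
  have h5 : (v / 2) ^+ 2 = v ^+ 2 / 4 by field.
  have v2 : 0 <= v ^+ 2 by rewrite sqr_ge0.
  rewrite h5 [expR 2 * _]mulrC !ler_norml => /andP[h1 h2].
  by apply/andP; split; lra.
rewrite [leRHS](_ : _ = 36 * expR 2 * M * s ^+ 3 + expR 2 * M * s ^+ 3); last first.
  by rewrite -vsE; ring.
rewrite (_ : gauss_avg v f x - f x - b * v / 2 =
  (gauss_avg v f x - f x - b * (expR (v / 2) - 1))
  + b * (expR (v / 2) - 1 - v / 2)); last by field.
by apply: (le_trans (ler_normD _ _)); exact: lerD.
Qed.

(** [a] and [b] stand for the first two derivatives at [x]; stating the expansion itself lets
    splines qualify by direct computation. *)
Definition taylor_bounded M f := forall x, exists a b, [/\ `|a| <= M, `|b| <= M &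
  forall u, `|f (x + u) - f x - a * u - b * u ^+ 2 / 2| <= M * `|u| ^+ 3].

(* The mean of [f (x + dl * (X - p))] for a Bernoulli variable [X] of parameter [p]. *)
Definition bernoulli_avg p dl f x :=
  (1 - p) * f (x - p * dl) + p * f (x + (1 - p) * dl).

(** Centering removes the linear term, and the third absolute moment is the variance times
    [dl (p^2 + (1 - p)^2) <= dl]. *)
Lemma bernoulli_avg_taylor f x (a b : R) M p dl : 0 <= p <= 1 -> 0 <= dl ->
  (forall u, `|f (x + u) - f x - a * u - b * u ^+ 2 / 2| <= M * `|u| ^+ 3) ->
  `|bernoulli_avg p dl f x - f x - b * (p * (1 - p) * dl ^+ 2) / 2|
  <= M * (p * (1 - p) * dl ^+ 2) * dl.
Proof.
move=> /andP[p0 p1] dl0 taylor.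
have M0 : 0 <= M by have := le_trans (normr_ge0 _) (taylor 1); rewrite normr1 expr1n mulr1.
have := taylor (- p * dl); have := taylor ((1 - p) * dl).
rewrite !normrM normrN (ger0_norm dl0) (ger0_norm p0) (ger0_norm (x := 1 - p)) ?subr_ge0//.
rewrite /bernoulli_avg mulNr; set f1 := f _; set f2 := f (x + _); set f0 := f x.
set e1 := (X in `|X| <= _ -> _); set e2 := (X in _ -> `|X| <= _ -> _) => h1 h2.
rewrite (_ : _ - _ - _ = (1 - p) * e2 + p * e1); last first.
  by rewrite /e1 /e2 /f1 -/f2 -/f0; field.
apply: (le_trans (ler_normD _ _)); rewrite !normrM (ger0_norm p0).
rewrite (ger0_norm (x := 1 - p)) ?subr_ge0//.
apply: (@le_trans _ _ ((1 - p) * (M * (p * dl) ^+ 3) + p * (M * ((1 - p) * dl) ^+ 3))).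
  by apply: lerD; rewrite ler_wpM2l// subr_ge0.
rewrite [leLHS](_ : _ = (M * (p * (1 - p) * dl ^+ 2) * dl) * (p ^+ 2 + (1 - p) ^+ 2)); last by ring.
rewrite ler_piMr//; last by nra.
by rewrite !mulr_ge0// ?subr_ge0// exprn_ge0.
Qed.

(** Both means share the same second-order expansion. The remainders add up to 38 = 37 + 1, since
    [Num.sqrt v <= dl]. *)
Lemma bernoulli_gauss_avg f M p dl x : 0 <= p <= 1 -> 0 <= dl <= 1 ->
  unit_valued f -> taylor_bounded M f ->
  `|bernoulli_avg p dl f x - gauss_avg (p * (1 - p) * dl ^+ 2) f x| <=
  38 * expR 2 * M * dl * (p * (1 - p) * dl ^+ 2).
Proof.
move=> p01 /andP[dl0 dl1] uf tf; have [a [b [aM bM tfx]]] := tf x.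
have := bernoulli_avg_taylor p01 dl0 tfx.
set v := p * (1 - p) * dl ^+ 2.
have M0 : 0 <= M by exact: le_trans aM.
have /andP[p0 p1] := p01.
have vdl : v <= dl ^+ 2 by rewrite /v ler_piMl ?sqr_ge0//; nra.
have v0 : 0 <= v by rewrite /v !mulr_ge0 ?subr_ge0 ?sqr_ge0.
clearbody v; have e2 : 1 <= expR 2 :> R by rewrite -expR0 ler_expR.
have MvM : M * v * dl <= expR 2 * M * v * dl.
  by rewrite -!mulrA ler_peMl// !mulr_ge0.
have [v0'|v0'] := eqVneq v 0.
  rewrite v0' gauss_avg0 !mulr0 !mul0r subr0 => /le_trans; exact.
have v01 : 0 < v <= 1.
  by rewrite lt0r v0' v0/= (le_trans vdl)// exprn_ile1.
have := gauss_avg_taylor v01 uf aM bM tfx.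
have sdl : Num.sqrt v <= dl 
  by rewrite -[leRHS](ger0_norm dl0) -sqrtr_sqr ler_wsqrtr.
have : 37 * expR 2 * M * v * Num.sqrt v <= 37 * expR 2 * M * v * dl.
  by rewrite ler_wpM2l// !mulr_ge0// expR_ge0.
have -> : 38 * expR 2 * M * dl * v = 37 * expR 2 * M * v * dl + expR 2 * M * v * dl by ring.
move: MvM; set E := expR 2 * M * v * dl; set E' := M * v * dl.
set G := gauss_avg _ _ _; set B := bernoulli_avg _ _ _ _.
move=> h1 h2; rewrite !ler_norml => /andP[h3 h4] /andP[h5 h6].
by apply/andP; split; lra.
Qed.

Definition bernoulli_sum_avg dl f ps := foldr (fun p g => bernoulli_avg p dl g) f ps.

(** The coefficients are the law of the Bernoulli sum. The free [N] allows padding by zeros, so the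
    length of [ps] need not be compared with [n] later. *)
Lemma sum_bernoulli_pgf dl f ps N x : (size ps < N)%N ->
  \sum_(k < N) (bernoulli_pgf ps)`_k * f (x + (k%:R - \sum_(p <- ps) p) * dl) =
  bernoulli_sum_avg dl f ps x.
Proof.
elim: ps N x => [|p ps IH] N x.
  case: N => // N _; rewrite /bernoulli_pgf !big_nil big_ord_recl/=.
  rewrite coef1 mul1r subrr mul0r addr0 big1 ?addr0// => i _.
  by rewrite coef1 mul0r.
case: N => // N; rewrite ltnS => sN.
have size_pgf := leq_trans (size_bernoulli_pgf ps) sN.
rewrite /= /bernoulli_avg -!(IH N) ?big_cons//.
pose F k := f (x + (k%:R - (p + \sum_(r <- ps) r)) * dl).
transitivity (\sum_(k < N.+1) ((1 - p) * ((bernoulli_pgf ps)`_k * F k)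
    + p * (('X * bernoulli_pgf ps)`_k * F k))).
  apply: eq_bigr => k _; rewrite -/(F k) /bernoulli_pgf big_cons.
  by rewrite mulrDl mul_polyC -scalerAl coefD !coefZ; ring.
rewrite big_split/= -!mulr_sumr; congr (_ * _ + _ * _).
  rewrite big_ord_recr/= (leq_sizeP _ _ size_pgf)// mul0r addr0.
  by apply: eq_bigr => k _; congr (_ * f _); ring.
rewrite big_ord_recl/= coefXM/= mul0r add0r.
apply: eq_bigr => k _; rewrite coefXM/= /F /bump/= add1n -natr1.
by congr (_ * f _); ring.
Qed.

Lemma bernoulli_avg_unit_valued p dl f : 0 <= p <= 1 -> unit_valued f ->
  unit_valued (bernoulli_avg p dl f).
Proof.
move=> /andP[p0 p1] [mf f01]; split.
  apply: measurable_funD; apply: measurable_funM => //; apply: measurableT_comp => //;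
  exact: measurable_funD.
move=> x; have /andP[? ?] := f01 (x - p * dl).
have /andP[? ?] := f01 (x + (1 - p) * dl).
by rewrite /bernoulli_avg; apply/andP; split; nra.
Qed.

Lemma gauss_bernoulli_avgC v p dl f x : 0 <= v -> continuous f -> unit_valued f ->
  bernoulli_avg p dl (gauss_avg v f) x = gauss_avg v (bernoulli_avg p dl f) x.
Proof.
move=> v0 cf [mf f01]; rewrite /bernoulli_avg.
have f0 y : 0 <= f y by have /andP[] := f01 y.
have ush a : unit_valued (fun y => f (y + a)).
  by split=> //; apply: measurableT_comp => //; exact: measurable_funD.
rewrite !(gauss_avg_translate _ _ v0 cf f0) gauss_avg_affine//.
Qed.

(** Commuting the head Bernoulli average past the Gaussian one makes it act on [f] itself, so
    [taylor_bounded] is needed for [f] only and not for its Gaussian averages. The outer Gaussian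
    average then does not increase the error. *)
Lemma lindeberg_bernoulli f M dl ps x : 0 <= dl <= 1 ->
  continuous f -> unit_valued f -> taylor_bounded M f ->
  all (fun p => 0 <= p <= 1) ps ->
  let v := \sum_(p <- ps) p * (1 - p) * dl ^+ 2 in
  `|bernoulli_sum_avg dl f ps x - gauss_avg v f x| <= 38 * expR 2 * M * dl * v.
Proof.
move=> dl01 cf uf tf /=; elim: ps x => [x _|p ps IH x /= /andP[p01 ps01]].
  by rewrite big_nil gauss_avg0 subrr normr0 mulr0.
rewrite big_cons; set v := p * _ * _; set w := \sum_(_ <- _) _ in IH *.
have /andP[dl0 dl1] := dl01; have /andP[p0 p1] := p01.
have v0 : 0 <= v by rewrite /v !mulr_ge0 ?subr_ge0 ?sqr_ge0.
have w0 : 0 <= w.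
  rewrite /w big_seq sumr_ge0// => r /(allP ps01)/andP[r0 r1].
  by rewrite !mulr_ge0 ?subr_ge0 ?sqr_ge0.
set C := 38 * _ * _ * _ in IH *; clearbody w.
have ub := bernoulli_avg_unit_valued dl p01 uf.
have ug := gauss_avg_unit_valued v0 uf.
have step y : `|bernoulli_avg p dl f y - gauss_avg v f y| <= C * v.
  exact: bernoulli_gauss_avg.
have h1 : gauss_avg w (bernoulli_avg p dl f) x <= gauss_avg (w + v) f x + C * v.
  rewrite -gauss_avg_semigroup//; apply: gauss_avg_le => // y.
  by have := step y; rewrite ler_norml => /andP[_]; rewrite lerBlDl.
have h2 : gauss_avg (w + v) f x <= gauss_avg w (bernoulli_avg p dl f) x + C * v.
  rewrite -gauss_avg_semigroup//; apply: gauss_avg_le => // y.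
  by have := step y; rewrite ler_norml => /andP[+ _]; lra.
rewrite -(gauss_bernoulli_avgC _ _ _ w0 cf uf) in h1 h2.
have := IH (x - p * dl) ps01; have := IH (x + (1 - p) * dl) ps01.
rewrite [v + w]addrC /bernoulli_avg in h1 h2 *.
rewrite !ler_norml => /andP[h3 h4] /andP[h5 h6].
by apply/andP; split; nra.
Qed.

End lindeberg.

(** * Smooth steps from cubic splines *)

Section ramp.
Context {R : realType}.
Implicit Types (x y u a k M : R).

Definition pos_part x : R := Num.max x 0.

(** If [x] and [x + u] are both positive the remainder is exactly [u^3]; only opposite signs require
    an estimate. *)
Lemma pos_part_cube_taylor x u :
  `|pos_part (x + u) ^+ 3 - pos_part x ^+ 3 - 3 * pos_part x ^+ 2 * u
    - 3 * pos_part x * u ^+ 2| <= `|u| ^+ 3.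
Proof.
rewrite /pos_part -normrX.
have [xu|xu] := leP (x + u) 0; have [x0|x0] := leP x 0.
- by rewrite !expr0n/= !mulr0 !mul0r !subr0 normr0.
- have u0 : u <= 0 by lra.
  rewrite (ler0_norm (x := u ^+ 3)); last by rewrite exprS; nra.
  rewrite (_ : _ - _ - _ - _ = u ^+ 3 - (x + u) ^+ 3); last by ring.
  have h : u ^+ 3 <= (x + u) ^+ 3.
    rewrite -subr_ge0 (_ : _ - _ = x * ((x + u) ^+ 2 + (x + u) * u + u ^+ 2)); last by ring.
    by rewrite mulr_ge0 ?ltW//; nra.
  have h' : (x + u) ^+ 3 <= 0 by rewrite exprS mulr_le0_ge0 ?sqr_ge0.
  by rewrite ler_norml; apply/andP; split; lra.
- have u0 : 0 <= u by lra.
  rewrite !expr0n/= !mulr0 !mul0r !subr0 !ger0_norm ?exprn_ge0 ?(ltW xu)//.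
  by rewrite lerXn2r ?nnegrE ?(ltW xu)//; lra.
- by rewrite (_ : _ - _ - _ - _ = u ^+ 3)//; ring.
Qed.

(* The distribution function of a sum of three independent uniform variables on
   [[0, 1]], an integrated quadratic B-spline. *)
Definition ramp y : R :=
  (pos_part y ^+ 3 - 3 * pos_part (y - 1) ^+ 3
   + 3 * pos_part (y - 2) ^+ 3 - pos_part (y - 3) ^+ 3) / 6.

Lemma ramp_le0 y : y <= 0 -> ramp y = 0.
Proof.
by move=> y0; rewrite /ramp /pos_part !max_r; [|lra..]; rewrite expr0n/=; ring.
Qed.

Lemma ramp_ge3 y : 3 <= y -> ramp y = 1.
Proof. by move=> y3; rewrite /ramp /pos_part !max_l; [field|lra..]. Qed.

Lemma ramp_ge0_le1 y : 0 <= ramp y <= 1.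
Proof.
have [y0|y0] := leP y 0; first by rewrite ramp_le0// lexx ler01.
have [y3|y3] := leP 3 y; first by rewrite ramp_ge3// lexx ler01.
rewrite /ramp /pos_part (max_l (x := y) (ltW y0)) (max_r (x := y - 3)); last by lra.
have [y1|y1] := leP (y - 1) 0.
  rewrite (max_r (x := y - 2)); last by lra.
  have : 0 <= y ^+ 3 <= 1 by rewrite exprn_ge0 ?exprn_ile1//; lra.
  by rewrite !expr0n/=; lra.
have [y2|y2] := leP (y - 2) 0.
  pose t := y - 1; have [t0 t1] : 0 <= t /\ t <= 1 by rewrite /t; lra.
  have t2 : t ^+ 2 <= t by nra.
  have t2_ge0 : 0 <= t ^+ 2 by exact: sqr_ge0.
  have t3 : t ^+ 3 <= t ^+ 2 by rewrite exprS ler_piMl.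
  have : 0 <= t * (1 - t) ^+ 2 by rewrite mulr_ge0 ?sqr_ge0.
  rewrite (_ : t * _ = t - 2 * t ^+ 2 + t ^+ 3); last by ring.
  have -> : y ^+ 3 = t ^+ 3 + 3 * t ^+ 2 + 3 * t + 1 by rewrite /t; ring.
  by rewrite -/t !expr0n/=; lra.
(* By symmetry of the spline, [ramp y = 1 - (3 - y)^3 / 6] on this last piece. *)
rewrite expr0n/=; have : 0 <= (3 - y) ^+ 3 <= 1 by rewrite exprn_ge0 ?exprn_ile1//; lra.
rewrite (_ : (3 - y) ^+ 3 =
  6 - (y ^+ 3 - 3 * (y - 1) ^+ 3 + 3 * (y - 2) ^+ 3)); last by ring.
by lra.
Qed.

Lemma continuous_pos_part : continuous pos_part.
Proof. by move=> x; apply: continuous_max; [exact: cvg_id|exact: cvg_cst]. Qed.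

Lemma continuous_ramp : continuous ramp.
Proof.
have cp a : continuous (fun y => pos_part (y - a) ^+ 3).
  move=> y; apply: (@continuous_comp _ _ _ (fun y => pos_part (y - a)) (fun z => z ^+ 3)).
    apply: (@continuous_comp _ _ _ (fun y => y - a) pos_part).
      by apply: cvgB; [exact: cvg_id|exact: cvg_cst].
    exact: continuous_pos_part.
  exact: exprn_continuous.
have cp0 : continuous (fun y => pos_part y ^+ 3).
  by have := cp 0; under eq_fun do rewrite subr0.
move=> y; apply: cvgM; last exact: cvg_cst.
apply: cvgB; last exact: cp; apply: cvgD; last by apply: cvgM; [exact: cvg_cst|exact: cp].
by apply: cvgB; [exact: cp0|apply: cvgM; [exact: cvg_cst|exact: cp]].
Qed.

(** The witnesses are the first two derivatives. The cubic remainders enter with total weight (1 + 3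
    + 3 + 1) / 6 = 4/3. *)
Lemma taylor_bounded_ramp : taylor_bounded 2 ramp.
Proof.
move=> x; pose p k := pos_part (x - k).
exists ((pos_part x ^+ 2 - 3 * p 1 ^+ 2 + 3 * p 2 ^+ 2 - p 3 ^+ 2) / 2).
exists (pos_part x - 3 * p 1 + 3 * p 2 - p 3); split.
- rewrite /p /pos_part ler_norml.
  have [?|?] := leP x 0; have [?|?] := leP (x - 1) 0; have [?|?] := leP (x - 2) 0;
  have [?|?] := leP (x - 3) 0; rewrite ?expr0n/=; try lra; by apply/andP; split; nra.
- rewrite /p /pos_part ler_norml.
  by have [?|?] := leP x 0; have [?|?] := leP (x - 1) 0; have [?|?] := leP (x - 2) 0;
  have [?|?] := leP (x - 3) 0; rewrite ?expr0n/=; lra.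
move=> u; have := pos_part_cube_taylor x u.
have := pos_part_cube_taylor (x - 1) u; have := pos_part_cube_taylor (x - 2) u.
have := pos_part_cube_taylor (x - 3) u; rewrite /ramp -/(p 1) -/(p 2) -/(p 3).
rewrite ![x - _ + u]addrAC.
have : 0 <= `|u| ^+ 3 by rewrite exprn_ge0.
rewrite !ler_norml => ? /andP[? ?] /andP[? ?] /andP[? ?] /andP[? ?].
by apply/andP; split; lra.
Qed.

(** [(1 + k)^3] dominates [k], [k^2] and [k^3] at once, the factors of the three bounds. *)
Lemma taylor_bounded_rescale M (f : R -> R) a k : 0 <= k -> taylor_bounded M f ->
  taylor_bounded (M * (1 + k) ^+ 3) (fun y => 1 - f (k * (y - a))).
Proof.
move=> k0 tf x; have [b [c [bM cM fbc]]] := tf (k * (x - a)).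
have M0 : 0 <= M by exact: le_trans bM.
have k3 : 0 <= k ^+ 3 by rewrite exprn_ge0.
have k2 : 0 <= k ^+ 2 by rewrite exprn_ge0.
have kE : (1 + k) ^+ 3 = 1 + 3 * k + 3 * k ^+ 2 + k ^+ 3 by ring.
exists (- (b * k)), (- (c * k ^+ 2)); split.
- by rewrite normrN normrM (ger0_norm k0); apply: ler_pM => //; lra.
- by rewrite normrN normrM (ger0_norm k2); apply: ler_pM => //; lra.
move=> u /=; have -> : k * (x + u - a) = k * (x - a) + k * u by ring.
have := fbc (k * u); rewrite -normrN => h.
apply: (@le_trans _ _ (M * `|k * u| ^+ 3)).
  apply: le_trans h; rewrite [leLHS](_ : _ = `|- (f (k * (x - a) + k * u)
    - f (k * (x - a)) - b * (k * u) - c * (k * u) ^+ 2 / 2)|)//.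
  by congr `|_|; field.
rewrite normrM (ger0_norm k0) exprMn mulrA ler_wpM2r ?exprn_ge0//.
by rewrite ler_wpM2l//; lra.
Qed.

(** [ramp] rises over a length 3, so the factor [3 / e] fits the descent into [[a, a + e]]. *)
Definition smooth_step a e y := 1 - ramp (3 / e * (y - a)).

Lemma continuous_smooth_step a e : continuous (smooth_step a e).
Proof.
move=> y; apply: cvgB; first exact: cvg_cst.
apply: (@continuous_comp _ _ _ (fun y => 3 / e * (y - a)) ramp); last exact: continuous_ramp.
by apply: cvgM; [exact: cvg_cst|apply: cvgB; [exact: cvg_id|exact: cvg_cst]].
Qed.

Lemma smooth_step_unit_valued a e : unit_valued (smooth_step a e).
Proof.
split; first by apply: continuous_measurable_fun; exact: continuous_smooth_step.
by move=> y; have /andP[] := ramp_ge0_le1 (3 / e * (y - a)); rewrite /smooth_step; lra.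
Qed.

Lemma taylor_bounded_smooth_step a e : 0 < e ->
  taylor_bounded (2 * (1 + 3 / e) ^+ 3) (smooth_step a e).
Proof.
move=> e0; apply: taylor_bounded_rescale; first by rewrite divr_ge0 ?ltW.
exact: taylor_bounded_ramp.
Qed.

Lemma smooth_step_eq1 a e y : 0 < e -> y <= a -> smooth_step a e y = 1.
Proof.
move=> e0 ya; rewrite /smooth_step ramp_le0 ?subr0//.
by rewrite mulr_ge0_le0 ?subr_le0// divr_ge0 ?ltW.
Qed.

Lemma smooth_step_eq0 a e y : 0 < e -> a + e <= y -> smooth_step a e y = 0.
Proof.
move=> e0 ya; rewrite /smooth_step ramp_ge3 ?subrr//.
by rewrite mulrAC ler_pdivlMr// ler_wpM2l//; lra.
Qed.

End ramp.

(** * Quantitative normal approximation *)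

Section clt_bound.
Context {R : realType}.
Implicit Types (f : R -> R) (M v : R).

Lemma gauss_avg_near_id f M v x : 0 <= v <= 1 -> 0 <= M -> unit_valued f ->
  taylor_bounded M f -> `|gauss_avg v f x - f x| <= 38 * expR 2 * M * v.
Proof.
move=> /andP[v0 v1] M0 uf tf; have [->|vn0] := eqVneq v 0.
  by rewrite gauss_avg0 subrr normr0 mulr0.
have v01 : 0 < v <= 1 by rewrite lt0r vn0 v0.
have [a [b [aM bM tfx]]] := tf x.
have := gauss_avg_taylor v01 uf aM bM tfx.
have sv1 : Num.sqrt v <= 1 by rewrite -sqrtr1 ler_wsqrtr.
have e2 : 1 <= expR 2 :> R by rewrite -expR0 ler_expR.
have Mv0 : 0 <= M * v by rewrite mulr_ge0.
have MvE : M * v <= expR 2 * M * v by rewrite -mulrA ler_peMl.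
have : 37 * expR 2 * M * v * Num.sqrt v <= 37 * expR 2 * M * v.
  by rewrite ler_piMr// -!mulrA !mulr_ge0// ?expR_ge0.
rewrite (_ : 38 * expR 2 * M * v = 37 * expR 2 * M * v + expR 2 * M * v); last by ring.
have : 0 <= expR 2 * M * v by lra.
move: MvE; set E := expR 2 * M * v; set bv := b * v / 2.
set E37 := 37 * expR 2 * M * v; set G := gauss_avg _ _ _.
have : `|bv| <= M * v / 2.
  rewrite /bv !normrM (ger0_norm v0) (ger0_norm (x := 2^-1))//.
  by rewrite ler_wpM2r// ler_wpM2r.
rewrite !ler_norml => /andP[? ?] ? ? ? /andP[? ?].
by apply/andP; split; lra.
Qed.

(** By the semigroup law the larger variance is the smaller one followed by a Gaussian of variance
    [|v - 1|]. This pays for normalizing by a variance that is only asymptotically exact. *)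
Lemma gauss_avg_near1 f M v x : `|v - 1| <= 1 -> 0 <= M -> unit_valued f ->
  taylor_bounded M f ->
  `|gauss_avg v f x - gauss_avg 1 f x| <= 38 * expR 2 * M * `|v - 1|.
Proof.
move=> v1 M0 uf tf.
have near w r : 0 <= w -> 0 <= r <= 1 ->
    `|gauss_avg (w + r) f x - gauss_avg w f x| <= 38 * expR 2 * M * r.
  move=> w0 r01; have /andP[r0 _] := r01.
  rewrite -gauss_avg_semigroup// ler_norml lerBlDl lerNl opprB lerBlDl.
  have ug := gauss_avg_unit_valued r0 uf.
  apply/andP; split; apply: gauss_avg_le => // y;
    have := gauss_avg_near_id y r01 M0 uf tf; rewrite ler_norml => /andP[]; lra.
move: v1; rewrite ler_norml => /andP[v1 v1'].
have [v_le1|v_gt1] := leP v 1.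
  rewrite distrC [`|v - 1|]distrC (ger0_norm (x := 1 - v)) ?subr_ge0//.
  have v0 : 0 <= v by lra.
  have r01 : 0 <= 1 - v <= 1 by lra.
  by have := near _ _ v0 r01; rewrite (_ : v + (1 - v) = 1); last by ring.
rewrite (ger0_norm (x := v - 1)); last by lra.
have r01 : 0 <= v - 1 <= 1 by lra.
by have := near _ _ ler01 r01; rewrite (_ : 1 + (v - 1) = v); last by ring.
Qed.

Lemma sum_card_pgf n (w : {set 'I_n} -> R) (F : nat -> R) N : (n < N)%N ->
  \sum_(k < N) (\sum_(U : {set 'I_n}) w U *: 'X^#|U|)`_k * F k =
  \sum_(U : {set 'I_n}) w U * F #|U|.
Proof.
move=> nN; under eq_bigr do rewrite coef_sum mulr_suml.
rewrite exchange_big/=; apply: eq_bigr => U _.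
have UN : (#|U| < N)%N.
  by rewrite (leq_ltn_trans _ nN)// -[leqRHS]card_ord max_card.
rewrite (bigD1 (Ordinal UN))//= coefZ coefXn eqxx mulr1 big1 ?addr0// => k.
by rewrite -val_eqE/= => /negbTE kU; rewrite coefZ coefXn kU mulr0 mul0r.
Qed.

(** [v] is the exact variance E Y + E Y(Y - 1) - (E Y)^2 over [sigma^2]. The replacement costs a
    multiple of [v / sigma <= 2 / sigma], the change of Gaussian variance a multiple of
    [|v - 1|]. *)
Lemma uncovered_clt_bound d (T : measurableType d) (P : probability T R) n l
    (A : 'I_l -> {RV P >-> {set 'I_n}}) (m : 'I_l -> nat) f M (sigma : R)
    (a := avoid_prob R n m)
    (mu := n%:R * a 1%N)
    (v := (mu + n%:R * (n%:R - 1) * a 2%N - mu ^+ 2) / sigma ^+ 2) :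
  mutually_independent A ->
  (forall i, uniform_in (A i) [set S : {set 'I_n} | #|S| == m i]%SET) ->
  (forall i, (m i <= n)%N) ->
  1 <= sigma -> `|v - 1| <= 1 -> 0 <= M ->
  continuous f -> unit_valued f -> taylor_bounded M f ->
  `|\sum_(U : {set 'I_n}) uncovered_law A U * f ((#|U|%:R - mu) / sigma)
    - gauss_avg 1 f 0| <= 38 * expR 2 * M * (2 / sigma + `|v - 1|).
Proof.
move=> A_indep A_unif m_le sigma1 v1 M0 cf uf tf.
have sigma0 : 0 < sigma by lra.
have [ps [ps01 pgfE mean_ps var_ps]] :=
  @set_pgf_bernoulli R n l m (uncovered_law A) (@uncovered_law_ge0 _ _ _ _ _ _ A)
    m_le (sum_uncovered_law_subset A_indep A_unif).
have dl01 : 0 <= sigma^-1 <= 1 by rewrite invr_ge0 ltW//= invf_le1.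
have vE : \sum_(p <- ps) p * (1 - p) * sigma^-1 ^+ 2 = v.
  rewrite -mulr_suml exprVn; congr (_ / _).
  under eq_bigr do rewrite mulrBr mulr1 -expr2.
  rewrite sumrB -/(a 1%N) -/(a 2%N) -/mu in mean_ps var_ps *.
  by rewrite mean_ps in var_ps *; lra.
have -> : \sum_(U : {set 'I_n}) uncovered_law A U * f ((#|U|%:R - mu) / sigma) =
    bernoulli_sum_avg sigma^-1 f ps 0.
  rewrite -(@sum_bernoulli_pgf _ _ _ _ (maxn (size ps) n).+1) ?ltnS ?leq_maxl//.
  rewrite -pgfE (sum_card_pgf _ (fun k => f (0 + (k%:R - \sum_(p <- ps) p) * sigma^-1)))
    ?ltnS ?leq_maxr//.
  by apply: eq_bigr => U _; rewrite mean_ps add0r.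
have := lindeberg_bernoulli 0 dl01 cf uf tf ps01; rewrite /= vE => h1.
have h2 := gauss_avg_near1 0 v1 M0 uf tf.
have v2 : v <= 2 by move: v1; rewrite ler_norml => /andP[]; lra.
have C0 : 0 <= 38 * expR 2 * M by rewrite !mulr_ge0 ?expR_ge0.
set C := 38 * expR 2 * M in C0 h1 h2 *.
have h3 : C * sigma^-1 * v <= C * (2 / sigma).
  rewrite -mulrA ler_wpM2l// mulrC ler_wpM2r//; by have /andP[] := dl01.
rewrite mulrDr; move: h1 h2; set B := bernoulli_sum_avg _ _ _ _; set G := gauss_avg v f 0.
set H := gauss_avg 1 f 0.
rewrite !ler_norml => /andP[? ?] /andP[? ?]; by apply/andP; split; lra.
Qed.

End clt_bound.

(** * The exact variance *)

Section weierstrass.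
Context {R : realFieldType} (I : Type).
Implicit Types (r : seq I) (x : I -> R).

(** Weierstrass' inequality with a second-order upper bound; the range of [P] is carried along for
    the induction. *)
Lemma prod_onem_bounds r x (P := \prod_(i <- r) (1 - x i))
    (s := \sum_(i <- r) x i) : (forall i, 0 <= x i <= 1) ->
  0 <= P <= 1 /\ 1 - s <= P <= 1 - s + s ^+ 2.
Proof.
move=> x01; rewrite /P /s {P s}; elim: r => [|i r [/andP[P0 P1] /andP[Pge Ple]]].
  by rewrite !big_nil expr0n/=; lra.
have /andP[xi0 xi1] := x01 i.
rewrite !big_cons; set P := \prod_(_ <- _) _ in P0 P1 Pge Ple *.
have s0 : 0 <= \sum_(j <- r) x j by apply: sumr_ge0 => j _; have /andP[] := x01 j.
set s := \sum_(_ <- _) _ in Pge Ple s0 *; clearbody P s.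
split; first by nra.
have := mulr_ge0 xi0 s0; have := mulr_ge0 xi0 P0; have := sqr_ge0 (x i).
have : x i * (1 - s) <= x i * P by rewrite ler_wpM2l.
have : x i * P <= x i by rewrite ler_piMr.
by move=> ? ? ? ? ?; apply/andP; split; nra.
Qed.

End weierstrass.

Lemma binomial_ratio1 (R : realFieldType) n m : (0 < n)%N -> (m <= n)%N ->
  'C(n - 1, m)%:R / 'C(n, m)%:R = 1 - m%:R / n%:R :> R.
Proof.
move=> n0 mn; have n0' : n%:R != 0 :> R by rewrite pnatr_eq0 -lt0n.
have C0 : 'C(n, m)%:R != 0 :> R by rewrite pnatr_eq0 -lt0n bin_gt0.
have /(congr1 (fun k => k%:R : R)) := mul_bin_down n m.
rewrite !natrM (natrB _ mn) subn1 => E.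
apply: (mulfI n0'); rewrite mulrA E; field.
by rewrite n0' C0.
Qed.

(** From [exp s >= (1 + s/2)^2], whose excess over [1 + s] is exactly [(s/2)^2]. *)
Lemma kappa_lower_bound (R : realType) (c C s p : R) : 0 < c -> c < s ->
  s <= C -> p <= expR (- s) ->
  (c / 2) ^+ 2 / (1 + C / 2) ^+ 2 <= 1 - (1 + s) * p.
Proof.
move=> c0 cs sC pe.
have es : (1 + s / 2) ^+ 2 <= expR s.
  have h : 1 + s / 2 <= expR (s / 2) := expR_ge1Dx _.
  have h0 : 0 <= 1 + s / 2 by lra.
  have -> : expR s = expR (s / 2) ^+ 2 by rewrite expr2 -expRD; congr expR; field.
  by rewrite lerXn2r ?nnegrE ?expR_ge0.
have s0 : 0 < (1 + s / 2) ^+ 2 by rewrite exprn_gt0//; lra.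
have C0 : 0 < (1 + C / 2) ^+ 2 by rewrite exprn_gt0//; lra.
have ps : p <= ((1 + s / 2) ^+ 2)^-1.
  by apply: (le_trans pe); rewrite expRN lef_pV2 ?posrE ?expR_gt0.
have s1 : 0 <= 1 + s by lra.
have h := ler_wpM2l s1 ps.
apply: (@le_trans _ _ ((s / 2) ^+ 2 / (1 + s / 2) ^+ 2)).
  rewrite ler_pdivrMr// mulrAC ler_pdivlMr// -!exprMn lerXn2r ?nnegrE//.
  - by rewrite mulr_ge0//; lra.
  - by rewrite mulr_ge0//; lra.
  - by nra.
rewrite (_ : _ / _ = 1 - (1 + s) / (1 + s / 2) ^+ 2); last first.
  by field; rewrite gt_eqF//; lra.
by lra.
Qed.

Section approx.
Context {R : realType} (n l : nat) (m : 'I_l -> nat) (C c : R).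
Local Notation u := (density R n m).
Local Notation N := (n%:R : R).
Hypothesis n_ge2 : (1 < n)%N.
Hypothesis l_gt0 : (0 < l)%N.
Hypothesis m_le : forall i, (m i <= n)%N.
Hypothesis u_le : forall i, u i <= C / l%:R.
Hypothesis C_ge0 : 0 <= C.
Hypothesis Cl : C / l%:R <= 2^-1.
Hypothesis c_gt0 : 0 < c.
Hypothesis sum_gt : c < \sum_(i < l) u i.

Let S := \sum_(i < l) u i.
Let p := \prod_(i < l) (1 - u i).
Local Notation a := (avoid_prob R n m).
Let kappa := 1 - (1 + S) * p.

Let N_ge2 : 2 <= N. Proof. by rewrite ler_nat. Qed.

Let u_ge0 i : 0 <= u i. Proof. exact: divr_ge0. Qed.

Let u_half i : u i <= 2^-1. Proof. exact: le_trans (u_le i) Cl. Qed.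

Let S_le : S <= C.
Proof.
rewrite /S (le_trans (ler_sum _ (fun i _ => u_le i)))//.
rewrite sumr_const card_ord -(mulr_natr (C / _)) divfK//.
by rewrite pnatr_eq0 -lt0n.
Qed.

Lemma asym_meanE : asym_mean R n m = N * a 1.
Proof.
rewrite /asym_mean; congr (_ * _); apply: eq_bigr => i _.
by rewrite binomial_ratio1// ltnW.
Qed.

(** On [0, 1/2] one has [1 / (1 - u) <= 1 + 2 u <= exp (2 u)]. *)
Let p_ge : expR (- (2 * C)) <= p.
Proof.
apply: (@le_trans _ _ (expR (- (2 * S)))).
  by rewrite ler_expR lerN2 ler_wpM2l.
rewrite /S mulr_sumr -sumrN expR_sum; apply: ler_prod => i _.
rewrite expR_ge0/= expRN invf_ple ?posrE ?expR_gt0//; last first.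
  by have := u_half i; lra.
apply: le_trans (expR_ge1Dx _); rewrite -div1r.
have h1 := u_half i; have h2 := u_ge0 i; have h3 : 0 < 1 - u i by lra.
by rewrite (ler_pdivrMr _ _ h3); nra.
Qed.

Let p_le1 : p <= 1.
Proof.
have [//|/andP[]//] := @prod_onem_bounds R _ (index_enum 'I_l) u.
by move=> i; have := u_half i; have := u_ge0 i; lra.
Qed.

Let kappa_ge : (c / 2) ^+ 2 / (1 + C / 2) ^+ 2 <= kappa.
Proof.
apply: kappa_lower_bound sum_gt S_le _ => //.
rewrite /p -sumrN expR_sum; apply: ler_prod => i _.
apply/andP; split; last exact: expR_ge1Dx.
by have := u_half i; lra.
Qed.

Lemma asym_varianceE : asym_variance R n m = N * kappa * p.
Proof. by []. Qed.

Lemma asym_variance_ge :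
  N * ((c / 2) ^+ 2 / (1 + C / 2) ^+ 2) * expR (- (2 * C)) <= asym_variance R n m.
Proof.
rewrite asym_varianceE -(mulrA N _ (expR _)) -(mulrA N kappa) ler_wpM2l//.
apply: ler_pM; [by rewrite divr_ge0 ?sqr_ge0|exact: expR_ge0| |exact: p_ge].
exact: kappa_ge.
Qed.

Lemma variance_approx (mu := N * a 1) :
  `|(mu + N * (N - 1) * a 2 - mu ^+ 2) / asym_variance R n m - 1| <=
  (2 * C ^+ 2 / l%:R + 4 * C ^+ 2 / (N - 1)) / ((c / 2) ^+ 2 / (1 + C / 2) ^+ 2).
Proof.
have [t [tE ct tC]] : exists t, [/\ t = S, c < t & t <= C].
  by exists S; split; [|exact: sum_gt|exact: S_le].
have N2 : 2 <= N := N_ge2; have c0 : 0 < c := c_gt0; have C0 : 0 <= C := C_ge0.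
have p0 : 0 < p := lt_le_trans (expR_gt0 _) p_ge.
have k0 : 0 < (c / 2) ^+ 2 / (1 + C / 2) ^+ 2 by rewrite divr_gt0// exprn_gt0//; lra.
have kappa0 := lt_le_trans k0 kappa_ge.
have N0 : N != 0 by rewrite gt_eqF//; lra.
have a1E : a 1 = p by apply: (mulfI N0); rewrite -asym_meanE.
have N1 : 0 < N - 1 by lra.
(* A set that misses one point misses a second one with probability [1 - m / (n - 1)], which equals
   [(1 - u) (1 - r)]; so [r] measures the dependence between two points. *)
pose w i := u i / (1 - u i).
pose r i := w i / (N - 1).
have w_bounds i : u i <= w i <= u i + 2 * (C / l%:R) * u i.
  rewrite /w; have h1 := u_half i; have h2 := u_le i; have h3 := u_ge0 i.
  have h4 : 0 < 1 - u i by lra.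
  rewrite (ler_pdivlMr _ _ h4) (ler_pdivrMr _ _ h4).
  have e1 : 0 <= u i * (C / l%:R - u i) by rewrite mulr_ge0 ?subr_ge0.
  have e2 : 0 <= C / l%:R * u i * (1 - 2 * u i).
    by apply: mulr_ge0 (mulr_ge0 (le_trans h3 h2) h3) _; lra.
  have e3 : 0 <= u i ^+ 2 by exact: sqr_ge0.
  by apply/andP; split; lra.
have a2E : a 2 = p * (p * \prod_(i < l) (1 - r i)).
  rewrite /avoid_prob /p -!big_split/=; apply: eq_bigr => i _.
  have mi : (m i <= n - 1)%N.
    have := u_half i; rewrite /density ler_pdivrMr ?ltr0n ?(ltnW n_ge2)//.
    move=> h; rewrite -(ler_nat R) natrB ?(ltnW n_ge2)//; lra.
  have C1 : 'C(n - 1, m i)%:R != 0 :> R by rewrite pnatr_eq0 -lt0n bin_gt0.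
  have Cn : 'C(n, m i)%:R != 0 :> R by rewrite pnatr_eq0 -lt0n bin_gt0.
  have n1 : (0 < n - 1)%N by rewrite subn_gt0.
  rewrite (_ : _ / _ = ('C(n - 1, m i)%:R / 'C(n, m i)%:R)
      * ('C(n - 1 - 1, m i)%:R / 'C(n - 1, m i)%:R)); last first.
    by rewrite -subnDA; field; rewrite ?Cn ?C1.
  rewrite (binomial_ratio1 _ n1 mi) (binomial_ratio1 _ (ltnW n_ge2) (m_le i)).
  rewrite (natrB _ (ltnW n_ge2)) -/(u i); congr (_ * _).
  have : (m i)%:R = u i * N by rewrite /u /density divfK.
  move=> ->; rewrite /r /w; field.
  by apply/andP; split; [lra|have := u_half i; lra].
pose s := \sum_(i < l) r i; pose W := \sum_(i < l) w i.
have sE : s * (N - 1) = W.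
  by rewrite /s /r -mulr_suml divfK// gt_eqF.
have /andP[W1 W2] : t <= W <= t + 2 * (C / l%:R) * C.
  rewrite tE.
  apply/andP; split; first by apply: ler_sum => i _; have /andP[] := w_bounds i.
  rewrite (le_trans (ler_sum _ (fun i _ => (andP (w_bounds i)).2)))//.
  rewrite big_split/= -mulr_sumr lerD2l ler_wpM2l// mulr_ge0// divr_ge0//.
have W3 : W <= 2 * C.
  have h : (C / l%:R) * C <= 2^-1 * C by rewrite ler_wpM2r.
  lra.
have r01 i : 0 <= r i <= 1.
  have /andP[h1 h2] := w_bounds i; have h3 := u_half i; have h4 := u_ge0 i.
  have h5 : w i <= 1.
    by rewrite /w ler_pdivrMr; lra.
  have w0 : 0 <= w i := le_trans h4 h1.
  rewrite /r; apply/andP; split; first by rewrite divr_ge0// ltW.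
  by rewrite (ler_pdivrMr _ _ N1) mul1r (le_trans h5)//; lra.
have [_ /andP[Q1 Q2]] := prod_onem_bounds (index_enum 'I_l) r01.
rewrite -/s in Q1 Q2; set Q := \prod_(_ <- _) _ in Q1 Q2.
(* The terms of order [N^2] cancel here. What remains compares [(N - 1) (1 - Q)], which is close to
   [W], with the sum of the densities. *)
have -> : (mu + N * (N - 1) * a 2 - mu ^+ 2) / asym_variance R n m - 1 =
    p / kappa * ((N - 1) * (Q - 1) + t).
  rewrite asym_varianceE /mu a1E a2E -/Q /kappa -tE; field.
  rewrite tE -/kappa !gt_eqF//; lra.
have ES : `|(N - 1) * (Q - 1) + t| <= 2 * C ^+ 2 / l%:R + 4 * C ^+ 2 / (N - 1).
  have h1 : - W <= (N - 1) * (Q - 1).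
    by rewrite -sE mulrC -mulrN (ler_wpM2l (ltW N1))//; lra.
  have h2 : (N - 1) * (Q - 1) <= - W + W ^+ 2 / (N - 1).
    have -> : - W + W ^+ 2 / (N - 1) = (N - 1) * (- s + s ^+ 2).
      by rewrite -sE; field; rewrite gt_eqF.
    by rewrite (ler_wpM2l (ltW N1))//; lra.
  have h3 : W ^+ 2 / (N - 1) <= 4 * C ^+ 2 / (N - 1).
    rewrite ler_wpM2r ?invr_ge0 ?(ltW N1)// (_ : 4 * C ^+ 2 = (2 * C) ^+ 2); last by ring.
    by rewrite lerXn2r ?nnegrE//; lra.
  have h4 : 2 * C ^+ 2 / l%:R = 2 * (C / l%:R) * C by ring.
  have h5 : 0 <= 4 * C ^+ 2 / (N - 1) by rewrite divr_ge0 ?mulr_ge0 ?sqr_ge0// (ltW N1).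
  rewrite h4 ler_norml; apply/andP; split; lra.
rewrite normrM; set E := (X in _ <= X / _) in ES *.
rewrite [leRHS]mulrC; apply: ler_pM => //.
rewrite ger0_norm; last by rewrite divr_ge0 ?ltW.
rewrite -[leRHS]mul1r; apply: ler_pM.
- exact: ltW.
- by rewrite invr_ge0 ltW.
- exact: p_le1.
- by rewrite lef_pV2 ?posrE//; exact: kappa_ge.
Qed.

End approx.

(** * Convergence in distribution *)

Section normal_cdf.
Context {R : realType}.
Implicit Types (a e : R).

Definition normal_cdf a : R := fine (normal_prob 0 1 `]-oo, a]%classic).

Lemma EFin_normal_cdf a : (normal_cdf a)%:E = normal_prob 0 1 `]-oo, a]%classic.
Proof. by rewrite fineK// fin_num_measure. Qed.

Lemma unit_valued_indic (A : set R) : measurable A -> unit_valued (\1_A : R -> R).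
Proof.
move=> mA; split=> [|y]; first exact: measurable_indic.
by rewrite indicE; case: (_ \in _); rewrite lexx ler01.
Qed.

Lemma gauss_avg_indic a : gauss_avg 1 \1_(`]-oo, a]) 0 = normal_cdf a :> R.
Proof.
rewrite (gauss_avgE _ _ (oner_neq0 R)) sqrtr1 /Rintegral /normal_cdf /normal_prob.
apply: (congr1 fine); rewrite [RHS]integral_mkcond; apply: eq_integral => y _.
rewrite indicE patchE; case: (y \in _); first by rewrite mul1r.
by rewrite mul0r.
Qed.

Lemma gauss_avg_smooth_step_ge a e : 0 < e ->
  normal_cdf a <= gauss_avg 1 (smooth_step a e) 0.
Proof.
move=> e0; rewrite -gauss_avg_indic -[leRHS]addr0.
apply: gauss_avg_le; [exact: unit_valued_indic|exact: smooth_step_unit_valued|].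
move=> y; rewrite addr0 indicE; case: (boolP (y \in _)) => [|_].
  by rewrite inE/= in_itv/= => ya; rewrite smooth_step_eq1.
by have [_ /(_ y)/andP[]] := smooth_step_unit_valued a e.
Qed.

Lemma gauss_avg_smooth_step_le a e : 0 < e ->
  gauss_avg 1 (smooth_step a e) 0 <= normal_cdf (a + e).
Proof.
move=> e0; rewrite -gauss_avg_indic -[leRHS]addr0.
apply: gauss_avg_le; [exact: smooth_step_unit_valued|exact: unit_valued_indic|].
move=> y; rewrite addr0 indicE; case: (boolP (y \in _)) => [_|].
  by have [_ /(_ y)/andP[]] := smooth_step_unit_valued a e.
rewrite notin_setE/= in_itv/= => /negP; rewrite -ltNge => ya.
by rewrite smooth_step_eq0// ltW.
Qed.

End normal_cdf.

Unset Implicit Arguments.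

Section uncovered_clt.
Context {R : realType} (l : nat -> nat) (l_gt0 : forall n, (0 < l n)%N).
Context (m : forall n, 'I_(l n) -> nat) (m_le : forall n i, (m n i <= n)%N).
Context (d : nat -> measure_display) (T : forall n, measurableType (d n)).
Context (P : forall n, probability (T n) R).
Context (A : forall n, 'I_(l n) -> {RV (P n) >-> {set 'I_n}}).
Hypothesis A_indep : forall n, mutually_independent (A n).
Hypothesis A_unif : forall n i,
  uniform_in (A n i) [set S : {set 'I_n} | #|S| == m n i]%SET.
Hypothesis l_cvgy : l n @[n --> \oo] --> \oo.
Hypothesis density_bigO : exists C : R, \forall n \near \oo,
  forall j, density R n (m n) j <= C / (l n)%:R.
Context (c : R) (c_gt0 : 0 < c).
Hypothesis sum_gt : \forall n \near \oo, c < \sum_(i < l n) density R n (m n) i.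

Let sigma n := Num.sqrt (asym_variance R n (m n)).

Lemma uncovered_cvg (f : R -> R) M : 0 <= M -> continuous f -> unit_valued f ->
  taylor_bounded M f ->
  \sum_(U : {set 'I_n}) uncovered_law (A n) U
    * f ((#|U|%:R - asym_mean R n (m n)) / sigma n) @[n --> \oo]
  --> gauss_avg 1 f 0.
Proof.
move=> M0 cf uf tf; have [C0 C0P] := density_bigO; have c0 := c_gt0.
pose C := `|C0| + 1.
have C_ge0 : 0 <= C by rewrite addr_ge0.
have C0C : C0 <= C by rewrite /C; have := ler_norm C0; lra.
pose kappa := (c / 2) ^+ 2 / (1 + C / 2) ^+ 2.
have kappa0 : 0 < kappa by rewrite divr_gt0// exprn_gt0//; lra.
pose p := expR (- (2 * C)).
have p0 : 0 < p by exact: expR_gt0.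
have kp0 : 0 < kappa * p by exact: mulr_gt0.
apply/cvgrPdist_le => e e0.
have [K KE] : exists K, K = 38 * expR 2 * M by eexists.
have K0 : 0 <= K by rewrite KE !mulr_ge0// expR_ge0.
(* [b] is the tolerance for [|v - 1|] and [s0] the threshold for [sigma n]; each leaves an error of
   at most [e / 2]. [K + 1] replaces [K], which may be 0. *)
have [b bE] : exists b, b = Num.min 1 (e / (2 * (K + 1))) by eexists.
have b0 : 0 < b by rewrite bE lt_min ltr01/= divr_gt0//; lra.
have kb0 : 0 < kappa * b by exact: mulr_gt0.
have [s0 s0E] : exists s0, s0 = 1 + 4 * (K + 1) / e by eexists.
have l_ge (B : R) : \forall n \near \oo, B <= (l n)%:R.
  exact: (l_cvgy _ (nbhs_infty_ger B)).
near=> n.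
have n_ge2 : (1 < n)%N by near: n; exact: nbhs_infty_gt.
have u_le i : density R n (m n) i <= C / (l n)%:R.
  have h : forall j, density R n (m n) j <= C0 / (l n)%:R by near: n.
  by rewrite (le_trans (h i))// ler_wpM2r.
have sumn : c < \sum_(i < l n) density R n (m n) i by near: n.
have lR0 : 0 < (l n)%:R :> R by rewrite ltr0n.
have Cl : C / (l n)%:R <= 2^-1.
  rewrite ler_pdivrMr// ler_pdivlMl//; near: n; exact: l_ge.
have var_ge := asym_variance_ge (l_gt0 n) u_le Cl c_gt0 sumn.
have approx := variance_approx n_ge2 (l_gt0 n) (m_le n) u_le C_ge0 Cl c_gt0 sumn.
rewrite -/kappa -/p in var_ge approx.
have s0_ge1 : 1 <= s0 by rewrite s0E lerDl divr_ge0 ?ltW//; lra.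
have var_s0 : s0 ^+ 2 <= asym_variance R n (m n).
  apply: le_trans var_ge; rewrite -mulrA -ler_pdivrMr//.
  by near: n; exact: nbhs_infty_ger.
have sigma_ge : s0 <= sigma n.
  by rewrite /sigma -[leLHS](ger0_norm (x := s0)) -?sqrtr_sqr ?ler_wsqrtr//; lra.
have sigma2 : sigma n ^+ 2 = asym_variance R n (m n).
  by rewrite /sigma sqr_sqrtr// (le_trans _ var_s0)// sqr_ge0.
rewrite -sigma2 in approx.
have approx_b :
    (2 * C ^+ 2 / (l n)%:R + 4 * C ^+ 2 / (n%:R - 1)) / kappa <= b.
  rewrite ler_pdivrMr// mulrC.
  have h1 : 2 * C ^+ 2 / (l n)%:R <= kappa * b / 2.
    rewrite ler_pdivrMr// -ler_pdivrMl; last by rewrite divr_gt0.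
    by near: n; exact: l_ge.
  have n1 : 0 < n%:R - 1 :> R by rewrite subr_gt0 ltr1n.
  have h2 : 4 * C ^+ 2 / (n%:R - 1) <= kappa * b / 2.
    rewrite ler_pdivrMr// -ler_pdivrMl; last by rewrite divr_gt0.
    by rewrite lerBrDl; near: n; exact: nbhs_infty_ger.
  lra.
have {}approx := le_trans approx approx_b.
have b1 : b <= 1 by rewrite bE ge_min lexx.
have be : K * b <= e / 2.
  apply: (@le_trans _ _ ((K + 1) * (e / (2 * (K + 1))))).
    by apply: ler_pM => //; [exact: ltW|lra|by rewrite bE ge_min lexx orbT].
  by rewrite le_eqVlt; apply/orP; left; apply/eqP; field; rewrite gt_eqF//; lra.
have sigma1 : 1 <= sigma n by lra.
have Ks : K * (2 / sigma n) <= e / 2.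
  have sn0 : 0 < sigma n by lra.
  rewrite mulrA ler_pdivrMr//.
  have : e * s0 <= e * sigma n by rewrite ler_wpM2l// ltW.
  rewrite s0E mulrDr mulr1 (_ : e * (4 * (K + 1) / e) = 4 * (K + 1)); last first.
    by field; rewrite gt_eqF.
  by lra.
have := uncovered_clt_bound (A_indep n) (A_unif n) (m_le n) sigma1
  (le_trans approx b1) M0 cf uf tf.
rewrite -(asym_meanE n_ge2 (m_le n)) distrC => /le_trans; apply.
rewrite -KE mulrDr; have := ler_wpM2l K0 approx; rewrite (asym_meanE n_ge2 (m_le n)); lra.
Unshelve. all: by end_near. Qed.

Lemma cdf_sandwich (e g1 g2 F1 F2 F q qu qd : R) : `|g1 - F1| <= e / 2 ->
  `|g2 - F2| <= e / 2 -> `|q - qu| <= e / 2 -> `|q - qd| <= e / 2 ->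
  F <= F1 -> F2 <= F -> qd <= g2 -> g1 <= qu -> `|q - F| <= e.
Proof.
rewrite !ler_norml => /andP[? ?] /andP[? ?] /andP[? ?] /andP[? ?] ? ? ? ?.
by apply/andP; split; lra.
Qed.

(** The steps descending on [[x, x + r]] and [[x - r, x]] enclose the indicator, and their Gaussian
    means lie between [normal_cdf (x - r)] and [normal_cdf (x + r)]. The width [r] is fixed by
    continuity before [n] grows, as the Taylor constant blows up when [r] shrinks. *)
Lemma uncovered_cdf_cvg x : {for x, continuous normal_cdf} ->
  \sum_(U : {set 'I_n} | (#|U|%:R - asym_mean R n (m n)) / sigma n <= x)
    uncovered_law (A n) U @[n --> \oo] --> normal_cdf x.
Proof.
move=> cx; apply/cvgrPdist_le => e e0.
have e2 : 0 < e / 2 by rewrite divr_gt0.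
have /cvgrPdist_le/(_ _ e2)[h /= h0 hx] := cx.
pose r := h / 2; have r0 : 0 < r by rewrite divr_gt0.
have r_lt : `|r| < h by rewrite gtr0_norm// /r; lra.
have qr : `|normal_cdf x - normal_cdf (x + r)| <= e / 2.
  by apply: hx; rewrite /= opprD addNKr normrN.
have ql : `|normal_cdf x - normal_cdf (x - r)| <= e / 2.
  by apply: hx; rewrite /= opprB addrC subrK.
have cvg_step a : \sum_(U : {set 'I_n}) uncovered_law (A n) U
    * smooth_step a r ((#|U|%:R - asym_mean R n (m n)) / sigma n) @[n --> \oo]
  --> gauss_avg 1 (smooth_step a r) 0.
  apply: (uncovered_cvg _ (2 * (1 + 3 / r) ^+ 3)).
  - by rewrite mulr_ge0// exprn_ge0// addr_ge0// divr_ge0// ltW.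
  - exact: continuous_smooth_step.
  - exact: smooth_step_unit_valued.
  - exact: taylor_bounded_smooth_step.
have /cvgrPdist_le/(_ _ e2) step_up := cvg_step x.
have /cvgrPdist_le/(_ _ e2) step_dn := cvg_step (x - r).
near=> n.
have up : `|gauss_avg 1 (smooth_step x r) 0 - \sum_(U : {set 'I_n}) uncovered_law (A n) U
    * smooth_step x r ((#|U|%:R - asym_mean R n (m n)) / sigma n)| <= e / 2.
  by near: n.
have dn : `|gauss_avg 1 (smooth_step (x - r) r) 0 - \sum_(U : {set 'I_n}) uncovered_law (A n) U
    * smooth_step (x - r) r ((#|U|%:R - asym_mean R n (m n)) / sigma n)| <= e / 2.
  by near: n.
have le_up : \sum_(U : {set 'I_n} | (#|U|%:R - asym_mean R n (m n)) / sigma n <= x)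
    uncovered_law (A n) U <= \sum_(U : {set 'I_n}) uncovered_law (A n) U
    * smooth_step x r ((#|U|%:R - asym_mean R n (m n)) / sigma n).
  rewrite big_mkcond/=; apply: ler_sum => U _; case: ifPn => [Ux|_].
    by rewrite smooth_step_eq1// mulr1.
  rewrite mulr_ge0 ?uncovered_law_ge0//.
  by have [_ /(_ ((#|U|%:R - asym_mean R n (m n)) / sigma n))/andP[]] :=
    smooth_step_unit_valued x r.
have le_dn : \sum_(U : {set 'I_n}) uncovered_law (A n) U
    * smooth_step (x - r) r ((#|U|%:R - asym_mean R n (m n)) / sigma n) <=
    \sum_(U : {set 'I_n} | (#|U|%:R - asym_mean R n (m n)) / sigma n <= x)
    uncovered_law (A n) U.
  rewrite [leRHS]big_mkcond/=; apply: ler_sum => U _; case: ifPn => [_|].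
    rewrite ler_piMr ?uncovered_law_ge0//.
    by have [_ /(_ ((#|U|%:R - asym_mean R n (m n)) / sigma n))/andP[]] :=
      smooth_step_unit_valued (x - r) r.
  by rewrite -ltNge => Ux; rewrite smooth_step_eq0 ?mulr0// subrK ltW.
apply: cdf_sandwich up dn qr ql le_up le_dn _ _.
  exact: gauss_avg_smooth_step_ge.
exact: gauss_avg_smooth_step_le.
Unshelve. all: by end_near. Qed.

End uncovered_clt.

Theorem theorem5p3 (R : realType)
  (l : nat -> nat) (l_gt0 : forall n, (0 < l n)%N)
  (m : forall n, 'I_(l n) -> nat) (m_le : forall n i, (m n i <= n)%N)
  (d : nat -> measure_display) (T : forall n, measurableType (d n))
  (P : forall n, probability (T n) R)
  (A : forall n, 'I_(l n) -> {RV (P n) >-> {set 'I_n}})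
  (A_indep : forall n, mutually_independent (A n))
  (A_unif : forall n i,
    uniform_in (A n i) [set S : {set 'I_n} | #|S| == m n i]%SET)
  (l_cvgy : l n @[n --> \oo] --> \oo)
  (density_bigO : exists C : R, \forall n \near \oo,
    forall j, density R n (m n) j <= C / (l n)%:R)
  (c : R) (c_gt0 : 0 < c)
  (sum_gt : \forall n \near \oo, c < \sum_(i < l n) density R n (m n) i) :
  cvg_in_distribution
    (fun n => standardize (uncovered (A n))
       (asym_mean R n (m n)) (Num.sqrt (asym_variance R n (m n))))
    (normal_prob 0 1).
Proof.
move=> x cx.
have cx' : {for x, continuous normal_cdf}.
  by apply: fine_cvg; rewrite EFin_normal_cdf; exact: cx.
suff : cdf (standardize (uncovered (A n)) (asym_mean R n (m n))
    (Num.sqrt (asym_variance R n (m n)))) x @[n --> \oo] --> (normal_cdf x)%:E.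
  by rewrite EFin_normal_cdf.
under eq_fun do rewrite cdf_standardize_uncovered.
apply: cvg_EFin; first by near=> n.
exact: (uncovered_cdf_cvg _ l_gt0 _ m_le _ _ _ _ A_indep A_unif l_cvgy density_bigO _ c_gt0 sum_gt _ cx').
Unshelve. all: by end_near. Qed.
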